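(* Let $H$ be a subgroup of a discrete abelian group $G$, and let $\gamma$ be an action of $G/H$ on a $C^*$-algebra $A$. Let $q:G\to G/H$ be the quotient map, let $\beta:=\gamma\circ q$, and define $\Phi:A\times_\beta G\to A\times_\gamma(G/H)$ by $\Phi:=i_A\times(i_{G/H}\circ q)$. Then \[ \Psi(b)(\xi)=\Phi(\hat\beta_\xi^{-1}(b))\qquad (b\in A\times_\beta G,\ \xi\in\hat G) \] defines an isomorphism $\Psi$ of $A\times_\beta G$ onto the induced $C^*$-algebra $\operatorname{Ind}_{H^\perp}^{\hat G}(A\times_\gamma(G/H),\hat\gamma)$.
   Context: For an action $\alpha$ of a discrete group $G$ on a $C^*$-algebra $A$, $A\times_\alpha G$ is the crossed product, generated by its universal covariant representation $(i_A,i_G)$ in $M(A\times_\alpha G)$; the elements $i_A(a)i_G(s)$ span a dense subspace. For a covariant representation $(\pi,U)$, $\pi\times U$ denotes the corresponding representation of $A\times_\alpha G$. So $\Phi$ is the homomorphism with $\Phi(i_A(a)i_G(s))=i_A(a)i_{G/H}(s+H)$. When $G$ is abelian, the dual action $\hat\alpha$ of $\hat G$ on $A\times_\alpha G$ is characterised by $\hat\alpha_\xi(i_A(a)i_G(s))=\xi(s)i_A(a)i_G(s)$. $H^\perp=\{\xi\in\hat G:\xi|_H=1\}$ is a closed subgroup of the compact group $\hat G$ and is identified with the dual of $G/H$, so the dual action $\hat\gamma$ is an action of $H^\perp$ on $A\times_\gamma(G/H)$. If $L$ is a closed subgroup of a compact group $K$ and $\alpha:L\to\operatorname{Aut}B$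 is a continuous action on a $C^*$-algebra $B$, the induced $C^*$-algebra is $\operatorname{Ind}_L^K(B,\alpha)=\{f\in C(K,B):f(gh)=\alpha_h^{-1}(f(g))\text{ for }g\in K,\ h\in L\}$. *)

(* Defs.v *)
From HB Require Import structures.
From mathcomp Require Import all_boot all_order all_algebra.
From mathcomp Require Import complex.
From mathcomp Require Import all_classical all_reals all_analysis.

Set Implicit Arguments.
Unset Strict Implicit.
Unset Printing Implicit Defensive.
Import Order.TTheory GRing.Theory Num.Theory.
Import numFieldNormedType.Exports.
Local Open Scope classical_set_scope.
Local Open Scope ring_scope.
Local Open Scope complex_scope.

Declare Scope star_scope.
Delimit Scope star_scope with star.
Local Open Scope star_scope.
Local Obligation Tactic := (intros => /=; try by []).

(* No unit is assumed. *)
HB.mixin Record isStarAlgebra (K : numClosedFieldType) A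
    of GRing.Lmodule K A := {
  smul : A -> A -> A;
  adj : A -> A;
  smulA : associative smul;
  smulDl : left_distributive smul +%R;
  smulDr : right_distributive smul +%R;
  smulZl : forall (c : K) a b, smul (c *: a) b = c *: smul a b;
  smulZr : forall (c : K) a b, smul a (c *: b) = c *: smul a b;
  adjD : {morph adj : a b / a + b};
  adjZ : forall (c : K) a, adj (c *: a) = (c^*)%R *: adj a;
  adjM : forall a b, adj (smul a b) = smul (adj b) (adj a);
  adjK : involutive adj
}.

#[short(type="starAlgType")]
HB.structure Definition StarAlgebra (K : numClosedFieldType) :=
  {A of isStarAlgebra K A & GRing.Lmodule K A}.

Notation "a ** b" := (smul a b) (at level 40, left associativity) : star_scope.
Notation "a ^#" := (adj a) (at level 2, format "a ^#") : star_scope.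

Lemma smul0r (K : numClosedFieldType) (A : starAlgType K) (a : A) : 0 ** a = 0.
Proof. by apply: (addrI (0 ** a)); rewrite -smulDl !addr0. Qed.

Lemma smulr0 (K : numClosedFieldType) (A : starAlgType K) (a : A) : a ** 0 = 0.
Proof. by apply: (addrI (a ** 0)); rewrite -smulDr !addr0. Qed.

(* [`|a|] takes its values in [R[i]], as the norm of any normed space over
   [R[i]] does in the library. *)
HB.mixin Record isCStarNorm (R : realType) A
    of StarAlgebra R[i] A & NormedModule R[i] A := {
  norm_smul : forall a b : A, `|smul a b| <= `|a| * `|b|;
  norm_cstar : forall a : A, `|smul (adj a) a| = `|a| ^+ 2
}.

#[short(type="cstarAlgType")]
HB.structure Definition CStarAlgebra (R : realType) :=
  {A of isCStarNorm R A & StarAlgebra R[i] A & CompleteNormedModule R[i] A}.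

Record star_hom (K : numClosedFieldType) (A B : starAlgType K) (f : A -> B)
    : Prop := StarHom {
  star_homP : forall (c : K) a b, f (c *: a + b) = c *: f a + f b;
  star_homM : forall a b, f (a ** b) = f a ** f b;
  star_homJ : forall a, f a^# = (f a)^#
}.

Record star_aut (K : numClosedFieldType) (A : starAlgType K) :=
  StarAut {
  aut_fun :> A -> A;
  aut_inv : A -> A;
  aut_hom : star_hom aut_fun;
  aut_funK : cancel aut_fun aut_inv;
  aut_invK : cancel aut_inv aut_fun
}.

Section FunctionAlgebra.
Variables (T : Type) (K : numClosedFieldType) (A : starAlgType K).
Implicit Types f g : T -> A.

Let fmul f g : T -> A := fun t => f t ** g t.
Let fadj f : T -> A := fun t => (f t)^#.

Fact fct_smulA : associative fmul.
Proof. by move=> f g h; apply/funext => t; rewrite /fmul smulA. Qed.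
Fact fct_smulDl : left_distributive fmul +%R.
Proof. by move=> f g h; apply/funext => t; exact: smulDl. Qed.
Fact fct_smulDr : right_distributive fmul +%R.
Proof. by move=> f g h; apply/funext => t; exact: smulDr. Qed.
Fact fct_smulZl (c : K) f g : fmul (c *: f) g = c *: fmul f g.
Proof. by apply/funext => t; exact: smulZl. Qed.
Fact fct_smulZr (c : K) f g : fmul f (c *: g) = c *: fmul f g.
Proof. by apply/funext => t; exact: smulZr. Qed.
Fact fct_adjD : {morph fadj : f g / f + g}.
Proof. by move=> f g; apply/funext => t; exact: adjD. Qed.
Fact fct_adjZ (c : K) f : fadj (c *: f) = (c^*)%R *: fadj f.
Proof. by apply/funext => t; exact: adjZ. Qed.
Fact fct_adjM f g : fadj (fmul f g) = fmul (fadj g) (fadj f).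
Proof. by apply/funext => t; exact: adjM. Qed.
Fact fct_adjK : involutive fadj.
Proof. by move=> f; apply/funext => t; exact: adjK. Qed.

HB.instance Definition _ := isStarAlgebra.Build K (T -> A)
  fct_smulA fct_smulDl fct_smulDr fct_smulZl fct_smulZr
  fct_adjD fct_adjZ fct_adjM fct_adjK.
End FunctionAlgebra.

(* Double centralizers in the sense of Busby: linearity, boundedness and
   [L (a ** b) = L a ** b], [R (a ** b) = a ** R b] are automatic. *)
Record multiplier (R : realType) (B : cstarAlgType R) := Multiplier {
  mult_l : B -> B;
  mult_r : B -> B;
  mult_lr : forall a b, a ** mult_l b = mult_r a ** b
}.

Section MultiplierAlgebra.
Variables (R : realType) (B : cstarAlgType R).
Implicit Types (m n p : multiplier B) (a b x y : B) (c : R[i]).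

HB.instance Definition _ := gen_eqMixin (multiplier B).
HB.instance Definition _ := gen_choiceMixin (multiplier B).

Lemma multP m n :
  mult_l m =1 mult_l n -> mult_r m =1 mult_r n -> m = n.
Proof.
case: m n => l r h [l' r' h'] /= /funext el /funext er.
by subst l' r'; congr Multiplier; exact: Prop_irrelevance.
Qed.

Lemma smul_eq0l x : (forall a, a ** x = 0) -> x = 0.
Proof.
move=> h; have : `|x| ^+ 2 == 0 by rewrite -norm_cstar h normr0.
by rewrite expf_eq0 /= normr_eq0 => /eqP.
Qed.

Lemma smul_injl x y : (forall a, a ** x = a ** y) -> x = y.
Proof.
move=> h; apply/eqP; rewrite -subr_eq0 -scaleN1r; apply/eqP/smul_eq0l => a.
by rewrite smulDr smulZr h scaleN1r subrr.
Qed.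

Lemma smul_injr x y : (forall a, x ** a = y ** a) -> x = y.
Proof.
move=> h; rewrite -[x]adjK -[y]adjK; congr (_ ^#); apply: smul_injl => a.
by rewrite -[a]adjK -!adjM h.
Qed.

Lemma mult_lP m c a b : mult_l m (c *: a + b) = c *: mult_l m a + mult_l m b.
Proof.
by apply: smul_injl => x; rewrite smulDr smulZr !mult_lr smulDr smulZr.
Qed.

Lemma mult_rP m c a b : mult_r m (c *: a + b) = c *: mult_r m a + mult_r m b.
Proof.
by apply: smul_injr => x; rewrite smulDl smulZl -!mult_lr smulDl smulZl.
Qed.

Lemma mult_lD m a b : mult_l m (a + b) = mult_l m a + mult_l m b.
Proof. by rewrite -[a in LHS]scale1r mult_lP scale1r. Qed.

Lemma mult_rD m a b : mult_r m (a + b) = mult_r m a + mult_r m b.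
Proof. by rewrite -[a in LHS]scale1r mult_rP scale1r. Qed.

Lemma mult_l0 m : mult_l m 0 = 0.
Proof. by apply: (addrI (mult_l m 0)); rewrite -mult_lD !addr0. Qed.

Lemma mult_r0 m : mult_r m 0 = 0.
Proof. by apply: (addrI (mult_r m 0)); rewrite -mult_rD !addr0. Qed.

Lemma mult_lZ m c a : mult_l m (c *: a) = c *: mult_l m a.
Proof. by rewrite -[c *: a]addr0 mult_lP mult_l0 addr0. Qed.

Lemma mult_rZ m c a : mult_r m (c *: a) = c *: mult_r m a.
Proof. by rewrite -[c *: a]addr0 mult_rP mult_r0 addr0. Qed.

Program Definition mult0 : multiplier B := @Multiplier R B (fun=> 0) (fun=> 0) _.
Next Obligation.
by rewrite smulr0 smul0r.
Qed.

Program Definition multD m n : multiplier B := @Multiplier R B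
  (fun x => mult_l m x + mult_l n x) (fun x => mult_r m x + mult_r n x) _.
Next Obligation. by rewrite smulDr smulDl !mult_lr. Qed.

Program Definition multZ c m : multiplier B := @Multiplier R B
  (fun x => c *: mult_l m x) (fun x => c *: mult_r m x) _.
Next Obligation. by rewrite smulZr smulZl mult_lr. Qed.

Program Definition multM m n : multiplier B := @Multiplier R B
  (fun x => mult_l m (mult_l n x)) (fun x => mult_r n (mult_r m x)) _.
Next Obligation. by rewrite !mult_lr. Qed.

Program Definition multJ m : multiplier B := @Multiplier R B
  (fun x => (mult_r m x^#)^#) (fun x => (mult_l m x^#)^#) _.
Next Obligation.
by rewrite -[a in LHS]adjK -adjM -mult_lr adjM adjK.
Qed.

Program Definition mult1 : multiplier B := @Multiplier R B id id _.

Fact multDA : associative multD.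
Proof. by move=> m n p; apply: multP => x /=; rewrite addrA. Qed.
Fact multDC : commutative multD.
Proof. by move=> m n; apply: multP => x /=; rewrite addrC. Qed.
Fact mult0D : left_id mult0 multD.
Proof. by move=> m; apply: multP => x /=; rewrite add0r. Qed.
Fact multND : left_inverse mult0 (multZ (-1)) multD.
Proof. by move=> m; apply: multP => x /=; rewrite scaleN1r addNr. Qed.

HB.instance Definition _ :=
  GRing.isZmodule.Build (multiplier B) multDA multDC mult0D multND.

Fact multZA c d m : multZ c (multZ d m) = multZ (c * d) m.
Proof. by apply: multP => x /=; rewrite scalerA. Qed.
Fact mult1Z : left_id 1 multZ.
Proof. by move=> m; apply: multP => x /=; rewrite scale1r. Qed.
Fact multZDr : right_distributive multZ +%R.
Proof. by move=> c m n; apply: multP => x /=; rewrite scalerDr. Qed.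
Fact multZDl m : {morph multZ^~ m : c d / c + d}.
Proof. by move=> c d; apply: multP => x /=; rewrite scalerDl. Qed.

HB.instance Definition _ := GRing.Zmodule_isLmodule.Build R[i] (multiplier B)
  multZA mult1Z multZDr multZDl.

Fact multMA : associative multM.
Proof. by move=> m n p; apply: multP. Qed.
Fact multMDl : left_distributive multM +%R.
Proof. by move=> m n p; apply: multP => x //=; rewrite mult_rD. Qed.
Fact multMDr : right_distributive multM +%R.
Proof. by move=> m n p; apply: multP => x //=; rewrite mult_lD. Qed.
Fact multMZl c m n : multM (c *: m) n = c *: multM m n.
Proof. by apply: multP => x //=; rewrite mult_rZ. Qed.
Fact multMZr c m n : multM m (c *: n) = c *: multM m n.
Proof. by apply: multP => x //=; rewrite mult_lZ. Qed.
Fact multJD : {morph multJ : m n / m + n}.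
Proof. by move=> m n; apply: multP => x /=; rewrite adjD. Qed.
Fact multJZ c m : multJ (c *: m) = (c^*)%R *: multJ m.
Proof. by apply: multP => x /=; rewrite adjZ. Qed.
Fact multJM m n : multJ (multM m n) = multM (multJ n) (multJ m).
Proof. by apply: multP => x /=; rewrite !adjK. Qed.
Fact multJK : involutive multJ.
Proof. by move=> m; apply: multP => x /=; rewrite !adjK. Qed.

HB.instance Definition _ := isStarAlgebra.Build R[i] (multiplier B)
  multMA multMDl multMDr multMZl multMZr multJD multJZ multJM multJK.

Program Definition mult_of b : multiplier B := @Multiplier R B
  (fun x => b ** x) (fun x => x ** b) _.
Next Obligation. by rewrite smulA. Qed.

End MultiplierAlgebra.

Arguments mult1 {R B}.

Record star_action (K : numClosedFieldType) (G : zmodType)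
    (A : starAlgType K) := StarAction {
  act :> G -> star_aut A;
  act0 : forall a, act 0 a = a;
  actD : forall s t a, act (s + t) a = act s (act t a)
}.

Section Pullback.
Variables (K : numClosedFieldType) (G Q : zmodType) (A : starAlgType K).
Variables (q : {additive G -> Q}) (gamma : star_action Q A).

Fact pullback0 a : gamma (q 0) a = a.
Proof. by rewrite raddf0 act0. Qed.
Fact pullbackD s t a : gamma (q (s + t)) a = gamma (q s) (gamma (q t) a).
Proof. by rewrite raddfD actD. Qed.

Definition action_pullback : star_action G A :=
  @StarAction K G A (fun s => gamma (q s)) pullback0 pullbackD.
End Pullback.

Definition lin_span (K : pzRingType) (V : lmodType K) (S : set V) : set V :=
  [set v | exists (n : nat) (c : 'I_n -> K) (w : 'I_n -> V),
    (forall i, S (w i)) /\ v = \sum_(i < n) c i *: w i].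

Section CrossedProduct.
Variables (R : realType) (G : zmodType) (A : cstarAlgType R).

(* A (nondegenerate) covariant representation of [(A, G, alpha)] in [M(D)];
   a representation on a Hilbert space is the case where [D] is the algebra of
   compact operators. *)
Record covariant (alpha : star_action G A) (D : cstarAlgType R)
    (pi : A -> multiplier D) (U : G -> multiplier D) : Prop := Covariant {
  cov_hom : star_hom pi;
  cov_nondeg : dense (lin_span [set d | exists a e, d = mult_l (pi a) e]);
  cov_unitl : forall s, (U s)^# ** U s = mult1;
  cov_unitr : forall s, U s ** (U s)^# = mult1;
  cov_U0 : U 0 = mult1;
  cov_UD : forall s t, U (s + t) = U s ** U t;
  cov_cov : forall s a, pi (alpha s a) = U s ** pi a ** (U s)^#
}.

(* [cp_gen a s] is the element [i_A(a) i_G(s)] of [M(B)]; it belongs to [B]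
   because [G] is discrete. *)
Record crossed_product (alpha : star_action G A) := CrossedProduct {
  cp_alg :> cstarAlgType R;
  cp_iA : A -> multiplier cp_alg;
  cp_iG : G -> multiplier cp_alg;
  cp_gen : A -> G -> cp_alg;
  cp_genE : forall a s, mult_of (cp_gen a s) = cp_iA a ** cp_iG s;
  cp_cov : covariant alpha cp_iA cp_iG;
  cp_dense : dense (lin_span [set b | exists a s, b = cp_gen a s]);
  cp_univ : forall (D : cstarAlgType R)
      (pi : A -> multiplier D) (U : G -> multiplier D),
    covariant alpha pi U ->
    exists L : cp_alg -> multiplier D,
      star_hom L /\ forall a s, L (cp_gen a s) = pi a ** U s
}.

(* [L = pi x U] *)
Definition integrated_form (alpha : star_action G A) (X : crossed_product alpha)
    (D : cstarAlgType R) (pi : A -> multiplier D) (U : G -> multiplier D)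
    (L : X -> multiplier D) : Prop :=
  star_hom L /\ forall a s, L (cp_gen X a s) = pi a ** U s.

End CrossedProduct.

Record dual_group (R : realType) (G : zmodType) := Character {
  char_fun :> G -> R[i];
  charD : forall s t, char_fun (s + t) = char_fun s * char_fun t;
  norm_char : forall s, `|char_fun s| = 1
}.

Section Dual.
Variables (R : realType) (G : zmodType).
Implicit Types xi eta : dual_group R G.

HB.instance Definition _ := gen_eqMixin (dual_group R G).
HB.instance Definition _ := gen_choiceMixin (dual_group R G).

Lemma charP xi eta : xi =1 eta -> xi = eta.
Proof.
case: xi eta => f hf nf [g hg ng] /= /funext e; subst g.
by congr Character; exact: Prop_irrelevance.
Qed.

Lemma char_neq0 xi s : xi s != 0.
Proof. by rewrite -normr_eq0 norm_char oner_neq0. Qed.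

Program Definition dual0 : dual_group R G := @Character R G (fun=> 1) _ _.
Next Obligation. by rewrite mulr1. Qed.
Next Obligation. by rewrite normr1. Qed.

Program Definition dual_add xi eta : dual_group R G :=
  @Character R G (fun s => xi s * eta s) _ _.
Next Obligation. by rewrite !charD mulrACA. Qed.
Next Obligation. by rewrite normrM !norm_char mulr1. Qed.

Program Definition dual_opp xi : dual_group R G :=
  @Character R G (fun s => (xi s)^-1) _ _.
Next Obligation. by rewrite charD invfM. Qed.
Next Obligation. by rewrite normfV norm_char invr1. Qed.

Fact dual_addA : associative dual_add.
Proof. by move=> x y z; apply: charP => s /=; rewrite mulrA. Qed.
Fact dual_addC : commutative dual_add.
Proof. by move=> x y; apply: charP => s /=; rewrite mulrC. Qed.
Fact dual_add0 : left_id dual0 dual_add.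
Proof. by move=> x; apply: charP => s /=; rewrite mul1r. Qed.
Fact dual_addN : left_inverse dual0 dual_opp dual_add.
Proof. by move=> x; apply: charP => s /=; rewrite mulVf // char_neq0. Qed.

(* The dual group is written additively: [(xi + eta) s = xi s * eta s]. *)
HB.instance Definition _ :=
  GRing.isZmodule.Build (dual_group R G) dual_addA dual_addC dual_add0 dual_addN.

Definition dual_ptws xi : {ptws G -> R[i]^o} := char_fun xi.
HB.instance Definition _ :=
  Topological.copy (dual_group R G) (initial_topology dual_ptws).

Definition annihilator (H : {pred G}) : set (dual_group R G) :=
  [set xi | forall h, h \in H -> xi h = 1].

End Dual.

Section DualQuotient.
Variables (R : realType) (G : zmodType) (H : zmodClosed G).
Local Open Scope quotient_scope.

Definition quot_map (s : G) : Quotient.quot H := \pi_(Quotient.quot H) s.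

Fact quot_map_additive : zmod_morphism quot_map.
Proof. exact: raddfB. Qed.
HB.instance Definition _ :=
  GRing.isZmodMorphism.Build G (Quotient.quot H) quot_map quot_map_additive.

Lemma quot_mapK (x : Quotient.quot H) : quot_map (repr x) = x.
Proof. exact: reprK. Qed.

Section Descend.
Variables (xi : dual_group R G) (xiH : annihilator H xi).

Lemma char_quot s t : quot_map s = quot_map t -> xi s = xi t.
Proof.
move=> /eqP; rewrite -Quotient.idealrBE => /xiH st.
by rewrite -[s](subrK t) charD st mul1r.
Qed.

Fact char_descendD (x y : Quotient.quot H) :
  xi (repr (x + y)) = xi (repr x) * xi (repr y).
Proof.
rewrite -charD; apply: char_quot.
by rewrite raddfD /= !quot_mapK.
Qed.

(* The character [s + H |-> xi s] of [G / H]: the identification of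
   [annihilator H] with [dual_group R (Quotient.quot H)]. *)
Definition char_descend : dual_group R (Quotient.quot H) :=
  @Character R (Quotient.quot H) (fun x => xi (repr x)) char_descendD
    (fun x => norm_char xi (repr x)).

Lemma char_descendE s : char_descend (quot_map s) = xi s.
Proof. by apply: char_quot; rewrite quot_mapK. Qed.
End Descend.
End DualQuotient.

Definition is_dual_action (R : realType) (G : zmodType) (A : cstarAlgType R)
    (alpha : star_action G A) (X : crossed_product alpha)
    (ahat : star_action (dual_group R G) X) : Prop :=
  forall xi a s, ahat xi (cp_gen X a s) = xi s *: cp_gen X a s.

(* The group [K] is written additively; the operations are those of
   [K -> B]. *)
Definition induced_cstar (R : realType) (K : PreTopologicalZmodule.type) (L : set K)
    (B : cstarAlgType R) (alpha : forall h, L h -> star_aut B)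
    : set (K -> B) :=
  [set f | continuous f /\
    forall g h (Lh : L h), f (g + h) = aut_inv (alpha h Lh) (f g)].

(* Main.v *)
(** Each [b |-> Psi b xi] is a star homomorphism, hence contractive, so the
    continuity of [Psi b] and its equivariance under the annihilator of [H] need
    only be checked on the generators [i_A(a) i_G(s)].

    [Psi] is isometric.  Since [beta] is trivial on [H] and [G] is abelian, the
    unitaries [i_G(h)], [h] in [H], are central in the multiplier algebra of
    [A x_beta G].  Given [b] and [r < |b|], a compactness argument yields numbers
    [lam h] of modulus one and a C*-seminorm [p] with [p b >= r] for which
    [lam h i_G(h)] acts as the identity; [lam] is then a character of [H], and it
    extends to a character [xi] of [G].  In the quotient by the kernel of [p] the
    unitaries [xi s i_G(s)] depend only on [s + H], so the universal property of
    [A x_gamma (G / H)] provides a representation that maps [Psi b xi] to the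
    class of [b], whence [r <= p b <= |Psi b xi|].

    [Psi] is onto.  Its range is complete, is dense in each fibre, and is stable
    under multiplication by the trigonometric polynomials in the values [xi h],
    [h] in [H]; as these separate the cosets of the annihilator of [H], a partition
    of unity on the compact dual group approximates any [f] in the induced algebra
    by elements of the range. *)
From HB Require Import structures.
From mathcomp Require Import all_boot all_order all_algebra.
From mathcomp Require cyclic separable cyclotomic.
From mathcomp Require Import complex zify ring lra.
From mathcomp Require Import all_classical all_reals all_analysis.
Require Import Defs.

Set Implicit Arguments.
Unset Strict Implicit.
Unset Printing Implicit Defensive.
Import Order.TTheory GRing.Theory Num.Theory.
Import numFieldNormedType.Exports.
Local Open Scope classical_set_scope.
Local Open Scope ring_scope.
Local Open Scope complex_scope.
Local Open Scope star_scope.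

(** * Real-valued norms *)

(** The obstacle is to pass from [|b|] to one fibre. A point of the joint spectrum of the central
    unitaries [i_G(h)] is wanted, but no spectral theory is invoked. Its substitute is the averages
    [(1 + w + .. + w ^ N) / (N + 1)] with [w = lam h i_G(h)]: central contractions that tend to the
    indicator of [w = 1]. The seminorm [p x] is the infimum of [|m x|] over finite products [m] of
    such averages. These are directed, so the C*-identity survives the infimum; and [m x] agrees
    with [x] modulo the kernel, so [p] is a quotient norm. Compactness picks [lam] in a product of
    circles. At a finite stage, roots of unity show that some phase keeps the norm up to a factor
    linear in the degree, and that factor is removed by passing to high powers.

    [lam] is multiplicative because [p b > 0]: both candidate values at [h + k] act alike on a
    nonzero class.

    In the surjectivity argument every weight must preserve the range. Hence the partition of unity
    is made of powers of trigonometric polynomials, and division by their sum is a Neumann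
    series. *)

Section RealNorm.
Variable R : realType.

(** The order of [R[i]] is only partial. The real part of the norm carries the same information and
    lets [lra] and the order of [R] be used. *)
Definition nrm (V : normedZmodType R[i]) (x : V) : R := complex.Re `|x|.

Lemma nrmE (V : normedZmodType R[i]) (x : V) : `|x| = (nrm x)%:C.
Proof. by rewrite /nrm RRe_real // realE normr_ge0. Qed.

Section Basic.
Variable V : normedZmodType R[i].
Implicit Types x y : V.

Lemma nrm_ge0 x : 0 <= nrm x. Proof. by rewrite -ler0c -nrmE normr_ge0. Qed.
Lemma nrm0 : nrm (0 : V) = 0. Proof. by rewrite /nrm normr0. Qed.
Lemma nrm_eq0 x : nrm x = 0 -> x = 0.
Proof. by move=> h; apply/normr0_eq0; rewrite nrmE h. Qed.
Lemma nrmN x : nrm (- x) = nrm x. Proof. by rewrite /nrm normrN. Qed.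
Lemma nrmB x y : nrm (x - y) = nrm (y - x). Proof. by rewrite /nrm distrC. Qed.
Lemma nrmD x y : nrm (x + y) <= nrm x + nrm y.
Proof. by rewrite -lecR rmorphD /= -!nrmE ler_normD. Qed.
Lemma nrm_tri x y z : nrm (x - z) <= nrm (x - y) + nrm (y - z).
Proof. by apply: le_trans (nrmD _ _); rewrite addrA subrK. Qed.
Lemma nrm_le x y : nrm x <= nrm y + nrm (x - y).
Proof. by rewrite addrC; apply: le_trans (nrmD _ _); rewrite subrK. Qed.
Lemma nrm_sum (I : Type) (r : seq I) (F : I -> V) :
  nrm (\sum_(i <- r) F i) <= \sum_(i <- r) nrm (F i).
Proof.
elim: r => [|i r ih]; first by rewrite !big_nil nrm0.
by rewrite !big_cons (le_trans (nrmD _ _)) // lerD2l.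
Qed.
Lemma nrm_small x : (forall e, 0 < e -> nrm x <= e) -> x = 0.
Proof.
move=> h; apply: nrm_eq0; apply/eqP; rewrite eq_le nrm_ge0 andbT.
by apply/ler_addgt0Pr => e e0; rewrite add0r h.
Qed.
End Basic.

Lemma nrmM (c d : R[i]) : nrm (c * d) = nrm c * nrm d.
Proof. by apply: (fmorph_inj (real_complex R)); rewrite rmorphM /= -!nrmE normrM. Qed.

Lemma nrmC (r : R) : nrm (r%:C : R[i]) = `|r|.
Proof. by apply: (fmorph_inj (real_complex R)); rewrite /= -nrmE normc_def /= expr0n addr0 sqrtr_sqr. Qed.

Lemma nrmZ (V : normedModType R[i]) (c : R[i]) (x : V) :
  nrm (c *: x) = nrm c * nrm x.
Proof. by apply: (fmorph_inj (real_complex R)); rewrite rmorphM /= -!nrmE normrZ. Qed.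

Lemma nrmZ1 (V : normedModType R[i]) (c : R[i]) (x : V) :
  nrm c = 1 -> nrm (c *: x) = nrm x.
Proof. by rewrite nrmZ => ->; rewrite mul1r. Qed.

Lemma ltcP (e : R[i]) : 0 < e -> exists2 r : R, 0 < r & e = r%:C.
Proof.
move=> e0; have er : e \is Num.real by rewrite realE ltW.
by exists (complex.Re e); rewrite ?RRe_real // -ltcR RRe_real.
Qed.

Lemma nrm_cvgP (V : normedModType R[i]) (T : Type) (F : set_system T)
    (f : T -> V) (y : V) : Filter F ->
  (f @ F --> y) <-> (forall e : R, 0 < e -> \forall t \near F, nrm (y - f t) < e).
Proof.
move=> FF; split => [/cvgrPdist_lt h e e0|h].
  have e0' : 0 < e%:C by rewrite ltcR.
  by apply: filterS (h _ e0') => t; rewrite nrmE ltcR.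
apply/cvgrPdist_lt => _ /ltcP[e e0 ->].
by apply: filterS (h e e0) => t; rewrite nrmE ltcR.
Qed.

Lemma nrm_denseP (V : normedModType R[i]) (S : set V) : dense S ->
  forall x e, 0 < e -> exists2 s, S s & nrm (x - s) < e.
Proof.
move=> dS x e e0; have e0' : 0 < e%:C by rewrite ltcR.
have [||s [xs Ss]] := dS (ball x e%:C).
- by exists x; exact: ballxx.
- exact: ball_open.
- by exists s => //; move: xs; rewrite -ball_normE /= nrmE ltcR.
Qed.

(** Serves the three limits of the proof: the square root, completeness of quotients, and
    surjectivity. The explicit tail bound makes later estimates hold at a chosen index. *)
Lemma geom_cvg (V : completeNormedModType R[i]) (u : nat -> V) (C q : R) :
  0 <= q -> q < 1 -> (forall n, nrm (u n.+1 - u n) <= C * q ^+ n) ->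
  exists l, forall n, nrm (l - u n) <= C * q ^+ n / (1 - q).
Proof.
move=> q0 q1 h.
have C0 : 0 <= C by have := h 0%N; rewrite expr0 mulr1; apply: le_trans; exact: nrm_ge0.
have q1' : 0 < 1 - q by rewrite subr_gt0.
have key n k : nrm (u (n + k)%N - u n) <= C * q ^+ n / (1 - q).
  have : nrm (u (n + k)%N - u n) <= C * q ^+ n * \sum_(i < k) q ^+ i.
    elim: k => [|k ih]; first by rewrite addn0 subrr nrm0 big_ord0 mulr0.
    rewrite addnS; apply: le_trans (nrm_tri _ (u (n + k)%N) _) _.
    rewrite big_ord_recr /= mulrDr addrC lerD // (le_trans (h _)) //.
    by rewrite exprD mulrA.
  move=> /le_trans; apply; rewrite ler_wpM2l ?mulr_ge0 ?exprn_ge0 //.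
  rewrite -[(1 - q)^-1]mul1r ler_pdivlMr // mulrC -opprB mulNr -subrX1 opprB.
  by rewrite gerBl exprn_ge0.
have small e : 0 < e -> \forall n \near \oo, C * q ^+ n / (1 - q) < e.
  (* [C + 1] replaces [C], which may be zero. *)
  move=> e0; have e0' : 0 < e * (1 - q) / (C + 1) by rewrite divr_gt0 ?mulr_gt0 // ltr_wpDl.
  have qn : `|q| < 1 by rewrite ger0_norm.
  have := cvg_expr qn => /cvgrPdist_lt /(_ _ e0').
  apply: filterS => n; rewrite sub0r normrN ger0_norm ?exprn_ge0 // => hn.
  rewrite ltr_pdivrMr //; apply: le_lt_trans (_ : _ <= (C + 1) * q ^+ n) _.
    by rewrite ler_wpM2r ?exprn_ge0 // lerDl.
  by rewrite mulrC -ltr_pdivlMr // ltr_wpDl.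
have : cauchy (u @ \oo).
  apply: cauchy_exP => _ /ltcP[e e0 ->].
  have [N _ hN] := small _ e0.
  exists (u N); exists N => // n /= Nn; rewrite -ball_normE /= nrmE ltcR nrmB.
  by rewrite -(subnKC Nn) (le_lt_trans (key _ _)) // hN //=.
move=> /cauchy_cvg /cvg_ex[l /nrm_cvgP ul]; exists l => n.
apply/ler_addgt0Pr => e e0.
have [N _ hN] := ul _ e0.
apply: le_trans (nrm_tri _ (u (n + N)%N) _) _.
rewrite addrC lerD //; apply/ltW/hN; exact: leq_addl.
Qed.

End RealNorm.

(** * Contractivity of star homomorphisms *)

Lemma geom_small (R : realType) (C q e : R) :
  0 <= C -> 0 <= q -> q < 1 -> 0 < e -> exists n, C * q ^+ n < e.
Proof.
move=> C0 q0 q1 e0.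
have e0' : 0 < e / (C + 1) by rewrite divr_gt0 // ltr_wpDl.
have qn : `|q| < 1 by rewrite ger0_norm.
have := cvg_expr qn => /cvgrPdist_lt /(_ _ e0')[N _ /(_ N (leqnn N))].
rewrite /= sub0r normrN ger0_norm ?exprn_ge0 // => hn; exists N.
apply: le_lt_trans (_ : _ <= (C + 1) * q ^+ N) _.
  by rewrite ler_wpM2r ?exprn_ge0 // lerDl.
by rewrite mulrC -ltr_pdivlMr // ltr_wpDl.
Qed.

Section StarAlgebraFacts.
Variables (K : numClosedFieldType) (A : starAlgType K).
Implicit Types a b : A.

Lemma smulNl a b : (- a) ** b = - (a ** b).
Proof. by rewrite -scaleN1r smulZl scaleN1r. Qed.
Lemma smulrN a b : a ** (- b) = - (a ** b).
Proof. by rewrite -scaleN1r smulZr scaleN1r. Qed.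
Lemma smulBl a b c : (a - b) ** c = a ** c - b ** c.
Proof. by rewrite smulDl smulNl. Qed.
Lemma smulBr a b c : a ** (b - c) = a ** b - a ** c.
Proof. by rewrite smulDr smulrN. Qed.
Lemma adjN a : (- a)^# = - a^#.
Proof. by rewrite -[in LHS]scaleN1r adjZ rmorphN1 scaleN1r. Qed.
Lemma adjB a b : (a - b)^# = a^# - b^#.
Proof. by rewrite adjD adjN. Qed.
Lemma adj0 : (0 : A)^# = 0.
Proof. by rewrite -[X in X ^#](subrr 0) adjB subrr. Qed.
End StarAlgebraFacts.

Section StarHomFacts.
Variables (K : numClosedFieldType) (A B : starAlgType K) (f : A -> B).
Hypothesis hf : star_hom f.

Lemma star_homD a b : f (a + b) = f a + f b.
Proof. by have := star_homP hf 1 a b; rewrite !scale1r. Qed.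
Lemma star_hom0 : f 0 = 0.
Proof. by apply: (addrI (f 0)); rewrite -star_homD !addr0. Qed.
Lemma star_homZ c a : f (c *: a) = c *: f a.
Proof. by rewrite -[c *: a]addr0 (star_homP hf) star_hom0 addr0. Qed.
Lemma star_homB a b : f (a - b) = f a - f b.
Proof. by rewrite -scaleN1r star_homD star_homZ scaleN1r. Qed.
Lemma star_hom_sum (n : nat) (c : 'I_n -> K) (w : 'I_n -> A) :
  f (\sum_(i < n) c i *: w i) = \sum_(i < n) c i *: f (w i).
Proof.
elim: n c w => [|n ih] c w; first by rewrite !big_ord0 star_hom0.
by rewrite !big_ord_recr /= star_homD star_homZ ih.
Qed.
End StarHomFacts.

Lemma star_hom_comp (K : numClosedFieldType) (A B C : starAlgType K)
  (f : A -> B) (g : B -> C) : star_hom f -> star_hom g -> star_hom (g \o f).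
Proof.
move=> hf hg; split=> [c a b|a b|a] /=.
- by rewrite (star_homP hf) (star_homP hg).
- by rewrite (star_homM hf) (star_homM hg).
- by rewrite (star_homJ hf) (star_homJ hg).
Qed.

Lemma aut_inv_hom (K : numClosedFieldType) (A : starAlgType K)
  (f : star_aut A) : star_hom (aut_inv f).
Proof.
have inj := can_inj (aut_funK f); have h := aut_hom f.
by split=> [c a b|a b|a]; apply: inj;
  rewrite ?(star_homP h) ?(star_homM h) ?(star_homJ h) !aut_invK.
Qed.

Section CStarNorm.
Variables (R : realType) (B : cstarAlgType R).
Implicit Types (a b x y d : B) (m u : multiplier B).

Lemma nrm_smul a b : nrm (a ** b) <= nrm a * nrm b.
Proof. by rewrite -lecR rmorphM /= -!nrmE norm_smul. Qed.
Lemma nrm_adjM a : nrm (a^# ** a) = nrm a ^+ 2.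
Proof.
by apply: (fmorph_inj (real_complex R)); rewrite /= rmorphXn /= -!nrmE norm_cstar.
Qed.
Lemma nrm_adj a : nrm a^# = nrm a.
Proof.
have h b : nrm b <= nrm b^#.
  have [->|b0] := eqVneq (nrm b) 0; first exact: nrm_ge0.
  have bp : 0 < nrm b by rewrite lt_def b0 nrm_ge0.
  by rewrite -(ler_pM2r bp) -expr2 -nrm_adjM nrm_smul.
by apply/le_anti; rewrite h andbT; have := h a^#; rewrite adjK.
Qed.
Lemma nrm_Madj a : nrm (a ** a^#) = nrm a ^+ 2.
Proof. by rewrite -{1}[a]adjK nrm_adjM nrm_adj. Qed.

Lemma mult_lB m a b : mult_l m (a - b) = mult_l m a - mult_l m b.
Proof. by rewrite mult_lD -scaleN1r mult_lZ scaleN1r. Qed.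
Lemma mult_rB m a b : mult_r m (a - b) = mult_r m a - mult_r m b.
Proof. by rewrite mult_rD -scaleN1r mult_rZ scaleN1r. Qed.
Lemma mult_lM m a b : mult_l m (a ** b) = mult_l m a ** b.
Proof. by apply: smul_injl => x; rewrite mult_lr smulA -mult_lr smulA. Qed.
Lemma mult_rM m a b : mult_r m (a ** b) = a ** mult_r m b.
Proof. by apply: smul_injr => x; rewrite -mult_lr -!smulA -mult_lr. Qed.
Lemma mult1m m : mult1 ** m = m. Proof. exact: multP. Qed.
Lemma multm1 m : m ** mult1 = m. Proof. exact: multP. Qed.
Lemma mult1J : (mult1 : multiplier B)^# = mult1.
Proof. by apply: multP => x /=; rewrite adjK. Qed.
Lemma mult_lA m u x : mult_l (m ** u) x = mult_l m (mult_l u x).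
Proof. by []. Qed.
Lemma mult_lDm m u x : mult_l (m + u) x = mult_l m x + mult_l u x.
Proof. by []. Qed.
Lemma mult_lZm (c : R[i]) m x : mult_l (c *: m) x = c *: mult_l m x.
Proof. by []. Qed.
Lemma mult_lBm m u x : mult_l (m - u) x = mult_l m x - mult_l u x.
Proof. by rewrite -[- u]scaleN1r mult_lDm mult_lZm scaleN1r. Qed.
Lemma mult_of_inj : injective (@mult_of R B).
Proof. by move=> a b h; apply: smul_injr => x; have := congr1 (fun m => mult_l m x) h. Qed.
Lemma mult_of_hom : star_hom (@mult_of R B).
Proof.
split=> [c a b|a b|a]; apply: multP => x /=.
- by rewrite smulDl smulZl.
- by rewrite smulDr smulZr.
- by rewrite smulA.
- by rewrite smulA.
- by rewrite adjM adjK.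
- by rewrite adjM adjK.
Qed.

Lemma adj_mult_l m d :
  (mult_l m d)^# ** mult_l m d = d^# ** mult_l (m^# ** m) d.
Proof. by rewrite mult_lA [RHS]mult_lr /= adjK. Qed.

Lemma nrm_isom u d : u^# ** u = mult1 -> nrm (mult_l u d) = nrm d.
Proof.
move=> h; apply/eqP; rewrite -(eqrXn2 (n := 2)) ?nrm_ge0 //.
by rewrite -nrm_adjM adj_mult_l h /= nrm_adjM.
Qed.

(* [1 - y] is a square root of [1 - h ^ 2]; the recursion
   [y <- (h ^ 2 + y ^ 2) / 2] contracts the ball of radius [|h|]. *)
Lemma quasi_sqrt h : h^# = h -> nrm h < 1 ->
  exists y, [/\ y^# = y, y ** h = h ** y & y + y = h ** h + y ** y].
Proof.
move=> hs h1; pose q := nrm h; have q0 : 0 <= q := nrm_ge0 _.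
pose c := (2^-1 : R)%:C : R[i].
have cE : c + c = 1 by rewrite /c -rmorphD (_ : 2^-1 + 2^-1 = 1) ?rmorph1 //; lra.
have nc : nrm c = 2^-1 by rewrite nrmC ger0_norm // invr_ge0 ler0n.
have cc : (c^*)%R = c by rewrite conj_Creal //; apply/complex_realP; exists 2^-1.
pose u := fix u n := if n is n'.+1 then c *: (h ** h + u n' ** u n') else 0 : B.
have uS n : u n.+1 = c *: (h ** h + u n ** u n) by [].
have us n : (u n)^# = u n.
  by elim: n => [|n ih]; rewrite /= ?adj0 // adjZ cc adjD !adjM hs ih.
have uh n : u n ** h = h ** u n.
  elim: n => [|n ih]; first by rewrite /= smul0r smulr0.
  by rewrite uS smulZl smulZr smulDl smulDr !smulA -smulA ih smulA ih.
have un n : nrm (u n) <= q.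
  elim: n => [|n ih]; first by rewrite /= nrm0.
  rewrite uS nrmZ nc (le_trans (_ : _ <= 2^-1 * (q * q + q * q))) //.
    rewrite ler_wpM2l ?invr_ge0 // (le_trans (nrmD _ _)) // lerD //.
      exact: nrm_smul.
    by rewrite (le_trans (nrm_smul _ _)) // ler_pM ?nrm_ge0.
  have -> : 2^-1 * (q * q + q * q) = q * q by lra.
  by rewrite ler_piMl // ltW.
have du n : nrm (u n.+1 - u n) <= 1 * q ^+ n.
  elim: n => [|n ih].
    by rewrite /= subr0 expr0 mul1r (le_trans (un 1%N)) // ltW.
  rewrite !uS -scalerBr nrmZ nc -/(u n.+1).
  (* Both outer factors have norm at most [q], and the factor [c] of norm one half compensates for
     there being two terms. *)
  have -> : h ** h + u n.+1 ** u n.+1 - (h ** h + u n ** u n)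
     = u n.+1 ** (u n.+1 - u n) + (u n.+1 - u n) ** u n.
    by rewrite smulBr smulBl opprD addrACA subrr add0r addrA subrK.
  rewrite ler_pdivrMl // (le_trans (nrmD _ _)) //.
  rewrite mulr_natl mulr2n exprS mul1r lerD // (le_trans (nrm_smul _ _)) //.
    by rewrite ler_pM ?nrm_ge0 // -[q ^+ n]mul1r.
  by rewrite mulrC ler_pM ?nrm_ge0 // -[q ^+ n]mul1r.
have [y hy] := geom_cvg q0 h1 du.
have q1' : 0 < 1 - q by rewrite subr_gt0.
have {}hy e : 0 < e -> exists2 n, nrm (y - u n) <= e & nrm (y - u n.+1) <= e.
  move=> e0; have C0 : 0 <= (1 - q)^-1 by rewrite invr_ge0 ltW.
  have [n /ltW hn] := geom_small C0 q0 h1 e0.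
  exists n; apply: le_trans (hy _) _; rewrite mul1r mulrC //.
  by apply: le_trans hn; rewrite ler_wpM2l // exprS ler_piMl ?exprn_ge0 // ltW.
exists y; split.
- apply/eqP; rewrite -subr_eq0; apply/eqP/nrm_small => e e0.
  have e2 : 0 < e / 2 by rewrite divr_gt0.
  have [n hn _] := hy _ e2.
  have -> : y^# - y = (y - u n)^# - (y - u n) by rewrite adjB us opprB addrA subrK.
  by rewrite (le_trans (nrmD _ _)) // nrmN nrm_adj [leRHS]splitr lerD.
- apply/eqP; rewrite -subr_eq0; apply/eqP/nrm_small => e e0.
  have e2 : 0 < e / 2 by rewrite divr_gt0.
  have [n hn _] := hy _ e2.
  have -> : y ** h - h ** y = (y - u n) ** h - h ** (y - u n).
    by rewrite smulBl smulBr uh opprB addrA subrK.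
  rewrite (le_trans (nrmD _ _)) // nrmN [leRHS]splitr lerD //.
    by rewrite (le_trans (nrm_smul _ _)) // -[leRHS]mulr1 ler_pM ?nrm_ge0 // ltW.
  by rewrite (le_trans (nrm_smul _ _)) // -[leRHS]mul1r ler_pM ?nrm_ge0 // ltW.
- apply/eqP; rewrite -subr_eq0; apply/eqP/nrm_small => e e0.
  (* [M] collects the coefficients of the error: 2 from [y + y], and [nrm y] and [q] from the two
     terms of [y ** y - u n ** u n]. *)
  pose M := 2 + q + (nrm y).
  have M0 : 0 < M by rewrite /M -addrA ltr_wpDr // addr_ge0 // nrm_ge0.
  have e2 : 0 < e / M by rewrite divr_gt0.
  have [n hn hn1] := hy _ e2.
  have -> : y + y - (h ** h + y ** y) = (y - u n.+1) + (y - u n.+1)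
     - (y ** (y - u n) + (y - u n) ** u n).
    have -> : y ** (y - u n) + (y - u n) ** u n = y ** y - u n ** u n.
      by rewrite smulBr smulBl addrA subrK.
    have {1}-> : h ** h = u n.+1 + u n.+1 - u n ** u n.
      by rewrite uS -scalerDl cE scale1r addrK.
    rewrite [in RHS]addrACA -[in RHS]opprD -[RHS]addrA -[in RHS]opprD.
    by congr (_ - _); rewrite -!addrA; congr (_ + (_ + _)); exact: addrC.
  rewrite (le_trans (nrmD _ _)) // nrmN.
  have -> : e = e / M * 1 + e / M * 1 + (nrm y * (e / M) + e / M * q).
    by rewrite -[LHS](@divfK _ M) ?gt_eqF // /M; ring.
  rewrite !mulr1 lerD // (le_trans (nrmD _ _)) // lerD //.
    by rewrite (le_trans (nrm_smul _ _)) // ler_wpM2l ?nrm_ge0.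
  by rewrite (le_trans (nrm_smul _ _)) // ler_pM ?nrm_ge0.
Qed.
End CStarNorm.

Section Contractive.
Variables (R : realType) (B D : cstarAlgType R) (L : B -> multiplier D).
Hypothesis hL : star_hom L.

(* With [k = L h] and [z = L y] for [y] as in [quasi_sqrt], the multiplier
   [k + i (1 - z)] is unitary and [k] is its real part. *)
Lemma star_hom_contr_sa1 h d : h^# = h -> nrm h < 1 -> nrm (mult_l (L h) d) <= nrm d.
Proof.
move=> hs h1; have [y [ys yh yy]] := quasi_sqrt hs h1.
pose k := L h; pose z := L y; pose e : multiplier D := mult1 - z.
have ks : k^# = k by rewrite /k -(star_homJ hL) hs.
have es : e^# = e by rewrite /e adjB mult1J /z -(star_homJ hL) ys.
have ke : e ** k = k ** e.
  by rewrite /e smulBl smulBr mult1m multm1 /k /z -!(star_homM hL) yh.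
have k2 : k ** k + e ** e = mult1.
  have zz : z + z = k ** k + z ** z.
    by rewrite /z /k -!(star_homM hL) -!(star_homD hL) yy.
  rewrite /e smulBl mult1m smulBr multm1 opprB.
  have -> : z ** z - z = z - k ** k by apply/eqP; rewrite subr_eq addrAC zz [k ** k + _]addrC addrK.
  by rewrite subrKA addrC subrK.
pose ii : R[i] := 'i%R.
have i2 : ii * ii = -1 by rewrite -expr2 sqrCi.
have ic : (ii^*)%R = - ii by rewrite conjCi.
have uu (c : R[i]) : c * c = -1 -> (k - c *: e) ** (k + c *: e) = mult1.
  move=> c2; rewrite smulBl !smulDr !smulZl !smulZr ke scalerA c2 scaleN1r.
  by rewrite opprD opprK addrA addrK k2.
pose u := k + ii *: e.
have uJ : u^# = k - ii *: e by rewrite /u adjD adjZ ic ks es scaleNr.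
have h1' : nrm (mult_l u d) = nrm d by apply: nrm_isom; rewrite uJ uu.
have h2' : nrm (mult_l (u^#) d) = nrm d.
  apply: nrm_isom; rewrite adjK uJ /u.
  by have := uu (- ii); rewrite mulrNN scaleNr opprK; apply.
have : mult_l k d + mult_l k d = mult_l u d + mult_l (u^#) d.
  by rewrite uJ mult_lBm /u !mult_lDm !mult_lZm addrACA subrr addr0.
move=> /(congr1 (@nrm R D)) H.
have : nrm (mult_l k d + mult_l k d) <= nrm d + nrm d.
  by rewrite H (le_trans (nrmD _ _)) // h1' h2'.
have -> : mult_l k d + mult_l k d = (2 : R)%:C *: mult_l k d.
  by rewrite (rmorph_nat (real_complex R) 2) scaler_nat mulr2n.
by rewrite nrmZ nrmC ger0_norm // -mulr2n -[in leRHS]mulr_natl ler_pM2l.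
Qed.

(** Multipliers carry no norm here, so the bound is stated on vectors [d]. The C*-identity reduces
    [a] to the self-adjoint [a^# ** a]. *)
Lemma star_hom_contr a d : nrm (mult_l (L a) d) <= nrm a * nrm d.
Proof.
have sa h e : h^# = h -> nrm (mult_l (L h) e) <= nrm h * nrm e.
  move=> hs; apply/ler_addgt0Pr => r r0.
  (* Dividing [h] by [t] makes its norm less than 1; the excess of [t] over [nrm h] costs at most
     [r] once multiplied by [nrm e]. *)
  pose t := nrm h + r / (1 + nrm e).
  have e1 : 0 < 1 + nrm e by rewrite ltr_wpDr // nrm_ge0.
  have ht : nrm h < t by rewrite ltrDl divr_gt0.
  have t0 : 0 < t by apply: le_lt_trans ht; exact: nrm_ge0.
  have nt : nrm ((t^-1)%:C : R[i]) = t^-1 by rewrite nrmC ger0_norm // invr_ge0 ltW.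
  have := @star_hom_contr_sa1 ((t^-1)%:C *: h) e.
  rewrite adjZ hs conj_Creal; last by apply/complex_realP; exists t^-1.
  rewrite nrmZ nt ltr_pdivrMl // mulr1 => /(_ erefl ht).
  rewrite (star_homZ hL) mult_lZm nrmZ nt ler_pdivrMl // => /le_trans; apply.
  rewrite /t mulrDl lerD // -mulrA ler_piMr ?(ltW r0) //.
  by rewrite ler_pdivrMl // mulr1 lerDr.
have : nrm (mult_l (L a) d) ^+ 2 <= (nrm a * nrm d) ^+ 2.
  rewrite -nrm_adjM adj_mult_l -(star_homJ hL) -(star_homM hL).
  rewrite (le_trans (nrm_smul _ _)) // nrm_adj.
  apply: le_trans (_ : _ <= nrm d * (nrm (a^# ** a) * nrm d)) _.
    by rewrite ler_wpM2l ?nrm_ge0 // sa // adjM adjK.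
  by rewrite nrm_adjM exprMn mulrCA -expr2.
by rewrite ler_pXn2r // nnegrE ?mulr_ge0 ?nrm_ge0.
Qed.
End Contractive.

Lemma star_hom_nrm_le (R : realType) (B D : cstarAlgType R) (f : B -> D) a :
  star_hom f -> nrm (f a) <= nrm a.
Proof.
(* The test vector [(f a)^#] turns the left side into [nrm (f a) ^+ 2], from which one factor
   cancels. *)
move=> hf; have := star_hom_contr (star_hom_comp hf (mult_of_hom D)) a (f a)^#.
rewrite /= nrm_Madj nrm_adj.
have [->|f0] := eqVneq (nrm (f a)) 0; first by rewrite nrm_ge0.
by rewrite expr2 ler_pM2r // lt_def f0 nrm_ge0.
Qed.

Lemma star_aut_nrm (R : realType) (B : cstarAlgType R) (f : star_aut B) a :
  nrm (f a) = nrm a.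
Proof.
apply/eqP; rewrite eq_le (star_hom_nrm_le _ (aut_hom f)) /=.
by rewrite -{1}[a](aut_funK f) (star_hom_nrm_le _ (aut_inv_hom f)).
Qed.

Lemma star_aut_inv_nrm (R : realType) (B : cstarAlgType R) (f : star_aut B) a :
  nrm (aut_inv f a) = nrm a.
Proof. by rewrite -{2}[a](aut_invK f) star_aut_nrm. Qed.

(** * Quotients by C*-seminorms *)

(* [csn_lift] says that [csn] is the quotient norm by its kernel, which is what
   makes the quotient complete. *)
Record cstar_seminorm (R : realType) (B : cstarAlgType R) := CStarSeminorm {
  csn :> B -> R;
  csnD : forall x y, csn (x + y) <= csn x + csn y;
  csnZ : forall (c : R[i]) x, csn (c *: x) = nrm c * csn x;
  csnM : forall x y, csn (x ** y) <= csn x * csn y;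
  csnJM : forall x, csn (x^# ** x) = csn x ^+ 2;
  csn_le : forall x, csn x <= nrm x;
  csn_lift : forall x e, 0 < e ->
    exists2 y, csn (x - y) = 0 & nrm y <= csn x + e
}.

Section SeminormFacts.
Variables (R : realType) (B : cstarAlgType R) (p : cstar_seminorm B).
Implicit Types x y : B.

Lemma csn0 : p 0 = 0.
Proof. by rewrite -(scale0r 0) csnZ nrm0 mul0r. Qed.
Lemma csnN x : p (- x) = p x.
Proof. by rewrite -scaleN1r csnZ nrmN /nrm normr1 mul1r. Qed.
Lemma csn_ge0 x : 0 <= p x.
Proof.
by have := csnD p x (- x); rewrite subrr csn0 csnN -mulr2n pmulrn_lge0.
Qed.
Lemma csnB x y : p (x - y) <= p x + p y.
Proof. by rewrite (le_trans (csnD _ _ _)) // csnN. Qed.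
Lemma csn_eq x y : p (x - y) = 0 -> p x = p y.
Proof.
move=> h; apply/le_anti/andP; split.
  by rewrite -[x in leLHS](subrK y) (le_trans (csnD _ _ _)) // h add0r.
by rewrite -[y in leLHS](subKr x) (le_trans (csnB _ _)) // h addr0.
Qed.
Lemma csn_adj x : p x^# = p x.
Proof.
have h b : p b <= p b^#.
  have [->|b0] := eqVneq (p b) 0; first exact: csn_ge0.
  have bp : 0 < p b by rewrite lt_def b0 csn_ge0.
  by rewrite -(ler_pM2r bp) -expr2 -csnJM csnM.
by apply/le_anti; rewrite h andbT; have := h x^#; rewrite adjK.
Qed.

(** No bound of [m] with respect to [p] is at hand, but the C*-identity gives
    [p (m x) ^+ 2 <= p x^# * p (m^# m x)], whose first factor vanishes. This is what lets
    multipliers descend to the quotient. *)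
Lemma csn_mult_l0 (m : multiplier B) x : p x = 0 -> p (mult_l m x) = 0.
Proof.
move=> x0; apply/eqP; rewrite -sqrf_eq0 -csnJM adj_mult_l eq_le csn_ge0 andbT.
by rewrite (le_trans (csnM _ _ _)) // csn_adj x0 mul0r.
Qed.
Lemma csn_mult_r0 (m : multiplier B) x : p x = 0 -> p (mult_r m x) = 0.
Proof.
move=> x0; have := @csn_mult_l0 m^# x^#.
by rewrite csn_adj /= adjK csn_adj; apply.
Qed.

Definition csn_ker : {pred B} := fun x => p x == 0.
Fact csn_ker_zmod_closed : zmod_closed csn_ker.
Proof.
split=> [|x y /eqP x0 /eqP y0]; first by rewrite unfold_in csn0.
by rewrite unfold_in eq_le csn_ge0 andbT (le_trans (csnB _ _)) // x0 y0 addr0.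
Qed.
HB.instance Definition _ := GRing.isZmodClosed.Build B csn_ker csn_ker_zmod_closed.
End SeminormFacts.

Section SeminormQuotient.
Variables (R : realType) (B : cstarAlgType R) (p : cstar_seminorm B).
Implicit Types (x y : B) (c : R[i]).

Definition cquot : Type := Quotient.quot (csn_ker p).
HB.instance Definition _ := GRing.Zmodule.on cquot.
Definition cqpi x : cquot := quot_map (csn_ker p) x.
Definition cqrep (a : cquot) : B := repr a.
Implicit Types a b : cquot.

Lemma cqrepK a : cqpi (cqrep a) = a.
Proof. exact: quot_mapK. Qed.
Lemma cqpiP x y : cqpi x = cqpi y <-> p (x - y) = 0.
Proof.
split=> [/eqP|/eqP h]; first by rewrite -Quotient.idealrBE => /eqP.
by apply/eqP; rewrite -Quotient.idealrBE.
Qed.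
Lemma cqpiD x y : cqpi (x + y) = cqpi x + cqpi y.
Proof. exact: raddfD. Qed.
Lemma cqpiB x y : cqpi (x - y) = cqpi x - cqpi y.
Proof. exact: raddfB. Qed.
Lemma cqpi0 : cqpi 0 = 0.
Proof. exact: raddf0. Qed.
Lemma cqrep_pi x : p (cqrep (cqpi x) - x) = 0.
Proof. by apply/cqpiP; rewrite cqrepK. Qed.

Let cqscale c a := cqpi (c *: cqrep a).
Let cqnorm a : R[i] := (p (cqrep a))%:C.
Let cqmul a b := cqpi (cqrep a ** cqrep b).
Let cqadj a := cqpi (cqrep a)^#.

Let cqscaleE c x : cqscale c (cqpi x) = cqpi (c *: x).
Proof. by apply/cqpiP; rewrite -scalerBr csnZ cqrep_pi mulr0. Qed.
Let cqmulE x y : cqmul (cqpi x) (cqpi y) = cqpi (x ** y).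
Proof.
apply/cqpiP/le_anti; rewrite csn_ge0 andbT.
set x' := cqrep _; set y' := cqrep _.
have -> : x' ** y' - x ** y = (x' - x) ** y' + x ** (y' - y).
  by rewrite smulBl smulBr addrA subrK.
rewrite (le_trans (csnD _ _ _)) //.
apply: le_trans (lerD (csnM _ _ _) (csnM _ _ _)) _.
by rewrite !cqrep_pi mul0r mulr0 addr0.
Qed.
Let cqadjE x : cqadj (cqpi x) = cqpi x^#.
Proof. by apply/cqpiP; rewrite -adjB csn_adj cqrep_pi. Qed.
Let cqnormE x : cqnorm (cqpi x) = (p x)%:C.
Proof. by congr (_%:C); apply/csn_eq/cqrep_pi. Qed.

Fact cqscaleA c d a : cqscale c (cqscale d a) = cqscale (c * d) a.
Proof. by rewrite -[a]cqrepK !cqscaleE scalerA. Qed.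
Fact cqscale1 : left_id 1 cqscale.
Proof. by move=> a; rewrite -[a]cqrepK !cqscaleE scale1r. Qed.
Fact cqscaleDr : right_distributive cqscale +%R.
Proof.
by move=> c a b; rewrite -[a]cqrepK -[b]cqrepK -cqpiD !cqscaleE scalerDr cqpiD.
Qed.
Fact cqscaleDl a : {morph cqscale^~ a : c d / c + d}.
Proof. by move=> c d; rewrite -[a]cqrepK !cqscaleE scalerDl cqpiD. Qed.
HB.instance Definition _ := GRing.Zmodule_isLmodule.Build R[i] cquot
  cqscaleA cqscale1 cqscaleDr cqscaleDl.

Lemma cqpiZ c x : cqpi (c *: x) = c *: cqpi x.
Proof. by rewrite -cqscaleE. Qed.

Fact cqnormD a b : cqnorm (a + b) <= cqnorm a + cqnorm b.
Proof.
by rewrite -[a]cqrepK -[b]cqrepK -cqpiD !cqnormE -rmorphD lecR csnD.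
Qed.
Fact cqnormZ c a : cqnorm (c *: a) = `|c| * cqnorm a.
Proof. by rewrite -[a]cqrepK -cqpiZ !cqnormE csnZ rmorphM /= -nrmE. Qed.
Fact cqnorm0_eq0 a : cqnorm a = 0 -> a = 0.
Proof.
rewrite -[a]cqrepK cqnormE -cqpi0 => /(fmorph_inj (real_complex R)) h.
by apply/cqpiP; rewrite subr0.
Qed.
HB.instance Definition _ :=
  @Lmodule_isNormed.Build R[i] cquot cqnorm cqnormD cqnormZ cqnorm0_eq0.

Lemma nrm_cqpi x : nrm (cqpi x) = p x.
Proof. by apply: (fmorph_inj (real_complex R)); rewrite /= -nrmE -cqnormE. Qed.

Fact cquot_complete (F : set_system cquot) : ProperFilter F -> cauchy F -> cvg F.
Proof.
move=> FF /cauchyP Fc.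
have h0 k : 0 < (2^-1 : R) ^+ k by rewrite exprn_gt0 // invr_gt0.
have /choice[z hz] : forall k, exists z, F (ball z ((2^-1 : R) ^+ k)%:C).
  by move=> k; apply: Fc; rewrite ltcR.
have zz k : nrm (z k.+1 - z k) <= 2^-1 ^+ k + 2^-1 ^+ k.
  have [a []] := filter_ex (filterI (hz k) (hz k.+1)).
  rewrite -!ball_normE /= !nrmE !ltcR => h1 h2.
  rewrite (le_trans (nrm_tri _ a _)) // [nrm (a - _)]nrmB lerD // ltW //.
  by rewrite (lt_le_trans h2) // exprS ler_piMl // ltW // invf_lt1 // ltr1n.
(* The constant 3 is 2 from [zz] plus 1 for the slack allowed by [csn_lift]. The lifted increments
   are then summable in [B], which is complete. *)
have /choice[d hd] : forall k, exists d, cqpi d = z k.+1 - z k /\ nrm d <= 3 * 2^-1 ^+ k.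
  move=> k; have [d hd1 hd2] := csn_lift p (cqrep (z k.+1 - z k)) (h0 k).
  exists d; split; first by rewrite -[RHS]cqrepK; apply/esym/cqpiP.
  rewrite (le_trans hd2) // -nrm_cqpi cqrepK.
  by have := zz k; lra.
pose u k := cqrep (z 0%N) + \sum_(i < k) d i.
have uz k : cqpi (u k) = z k.
  rewrite /u; elim: k => [|k ih]; first by rewrite big_ord0 addr0 cqrepK.
  by rewrite big_ord_recr /= addrA cqpiD ih (hd k).1 addrC subrK.
have [||n|l hl] := @geom_cvg R B u 3 2^-1.
- by rewrite invr_ge0.
- by rewrite invf_lt1 // ltr1n.
- have -> : u n.+1 = d n + u n by rewrite /u big_ord_recr /= addrA addrC.
  by rewrite addrK (hd n).2.
apply/cvg_ex; exists (cqpi l); apply/cvgrPdist_lt => _ /ltcP[e e0 ->].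
(* 7 is [3 / (1 - 1/2)] from the tail bound plus 1 for the radius of the ball around [z n]. *)
have [||||n hn] := @geom_small R 7 2^-1 e => //.
- by rewrite invf_lt1 // ltr1n.
have := hz n; apply: filterS => a; rewrite -ball_normE /= !nrmE !ltcR => ha.
rewrite (le_lt_trans (nrm_tri _ (z n) _)) // (le_lt_trans _ hn) //.
have : nrm (cqpi l - z n) <= 3 * 2^-1 ^+ n / (1 - 2^-1).
  by rewrite -uz -cqpiB nrm_cqpi (le_trans (csn_le _ _)).
have -> : (1 - 2^-1 : R)^-1 = 2 by apply: (mulIf (x := 1 - 2^-1)); [lra|rewrite mulVf; lra].
by move: ha; lra.
Qed.
HB.instance Definition _ := Uniform_isComplete.Build cquot cquot_complete.

Fact cqmulA : associative cqmul.
Proof.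
by move=> a b d; rewrite -[a]cqrepK -[b]cqrepK -[d]cqrepK !cqmulE smulA.
Qed.
Fact cqmulDl : left_distributive cqmul +%R.
Proof.
move=> a b d; rewrite -[a]cqrepK -[b]cqrepK -[d]cqrepK -cqpiD !cqmulE.
by rewrite -cqpiD smulDl.
Qed.
Fact cqmulDr : right_distributive cqmul +%R.
Proof.
move=> a b d; rewrite -[a]cqrepK -[b]cqrepK -[d]cqrepK -cqpiD !cqmulE.
by rewrite -cqpiD smulDr.
Qed.
Fact cqmulZl c a b : cqmul (c *: a) b = c *: cqmul a b.
Proof. by rewrite -[a]cqrepK -[b]cqrepK -cqpiZ !cqmulE -cqpiZ smulZl. Qed.
Fact cqmulZr c a b : cqmul a (c *: b) = c *: cqmul a b.
Proof. by rewrite -[a]cqrepK -[b]cqrepK -cqpiZ !cqmulE -cqpiZ smulZr. Qed.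
Fact cqadjD : {morph cqadj : a b / a + b}.
Proof.
by move=> a b; rewrite -[a]cqrepK -[b]cqrepK -cqpiD !cqadjE -cqpiD adjD.
Qed.
Fact cqadjZ c a : cqadj (c *: a) = (c^*)%R *: cqadj a.
Proof. by rewrite -[a]cqrepK -cqpiZ !cqadjE -cqpiZ adjZ. Qed.
Fact cqadjM a b : cqadj (cqmul a b) = cqmul (cqadj b) (cqadj a).
Proof. by rewrite -[a]cqrepK -[b]cqrepK !(cqmulE, cqadjE) adjM. Qed.
Fact cqadjK : involutive cqadj.
Proof. by move=> a; rewrite -[a]cqrepK !cqadjE adjK. Qed.
HB.instance Definition _ := isStarAlgebra.Build R[i] cquot
  cqmulA cqmulDl cqmulDr cqmulZl cqmulZr cqadjD cqadjZ cqadjM cqadjK.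

Lemma cqpiM x y : cqpi (x ** y) = cqpi x ** cqpi y.
Proof. by rewrite -cqmulE. Qed.
Lemma cqpiJ x : cqpi x^# = (cqpi x)^#.
Proof. by rewrite -cqadjE. Qed.

Fact cqnorm_smul a b : `|smul a b| <= `|a| * `|b|.
Proof.
by rewrite -[a]cqrepK -[b]cqrepK -cqpiM !nrmE !nrm_cqpi -rmorphM lecR csnM.
Qed.
Fact cqnorm_cstar a : `|smul (adj a) a| = `|a| ^+ 2.
Proof. by rewrite -[a]cqrepK -cqpiJ -cqpiM !nrmE !nrm_cqpi -rmorphXn csnJM. Qed.
HB.instance Definition _ := isCStarNorm.Build R cquot cqnorm_smul cqnorm_cstar.

Section MultiplierQuotient.
Variable m : multiplier B.

Let lq (a : cquot) : cquot := cqpi (mult_l m (cqrep a)).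
Let rq (a : cquot) : cquot := cqpi (mult_r m (cqrep a)).
Let lqE x : lq (cqpi x) = cqpi (mult_l m x).
Proof. by apply/cqpiP; rewrite -mult_lB csn_mult_l0 ?cqrep_pi. Qed.
Let rqE x : rq (cqpi x) = cqpi (mult_r m x).
Proof. by apply/cqpiP; rewrite -mult_rB csn_mult_r0 ?cqrep_pi. Qed.

Fact mquot_subproof a b : a ** lq b = rq a ** b.
Proof. by rewrite -[a]cqrepK -[b]cqrepK lqE rqE -!cqpiM mult_lr. Qed.
Definition mquot : multiplier cquot := Multiplier mquot_subproof.

Lemma mquot_l x : mult_l mquot (cqpi x) = cqpi (mult_l m x).
Proof. exact: lqE. Qed.
Lemma mquot_r x : mult_r mquot (cqpi x) = cqpi (mult_r m x).
Proof. exact: rqE. Qed.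
End MultiplierQuotient.

Lemma mquot_hom : star_hom mquot.
Proof.
split=> [c m n|m n|m]; apply: multP => a; rewrite -[a]cqrepK.
- by rewrite mquot_l [in LHS]/= cqpiD cqpiZ -!mquot_l.
- by rewrite mquot_r [in LHS]/= cqpiD cqpiZ -!mquot_r.
- by rewrite mquot_l [in LHS]/= -!mquot_l.
- by rewrite mquot_r [in LHS]/= -!mquot_r.
- by rewrite mquot_l [in LHS]/= cqpiJ -mquot_r cqpiJ.
- by rewrite mquot_r [in LHS]/= cqpiJ -mquot_l cqpiJ.
Qed.
Lemma mquot1 : mquot mult1 = mult1.
Proof. by apply: multP => a; rewrite -[a]cqrepK !(mquot_l, mquot_r). Qed.
End SeminormQuotient.

(** * Localization at central unitaries *)

Lemma numClosed_prim_root (C : numClosedFieldType) n :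
  (0 < n)%N -> exists w : C, n.-primitive_root w.
Proof.
move=> n0; have [r Dp] := closed_field_poly_normal ('X^n - 1 : {poly C}).
rewrite (monicP _) ?monicXnsubC // scale1r in Dp.
have [|||w _ wP] := hasP (cyclic.has_prim_root n0 (rs := r) _ _ _); last by exists w.
- by apply/allP=> z; rewrite -root_prod_XsubC -Dp.
- by rewrite -separable.separable_prod_XsubC -Dp cyclotomic.separable_Xn_sub_1 // pnatr_eq0 -lt0n.
- by rewrite -ltnS -(size_prod_XsubC r id) -Dp size_XnsubC.
Qed.

Lemma prim_root_sum (C : numClosedFieldType) n (w : C) k :
  n.-primitive_root w -> \sum_(t < n) (w ^+ k) ^+ t = if (n %| k)%N then n%:R else 0.
Proof.
move=> wP; have [/dvdnP[q ->]|nk] := boolP (n %| k)%N.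
  rewrite mulnC exprM (prim_expr_order wP) expr1n.
  by under eq_bigr do rewrite expr1n; rewrite sumr_const card_ord.
have wk : w ^+ k - 1 != 0 by rewrite subr_eq0 -(prim_order_dvd wP).
apply: (mulfI wk); rewrite mulr0 -subrX1 -exprM mulnC exprM.
by rewrite (prim_expr_order wP) expr1n subrr.
Qed.

Lemma bernoulli_ge (R : realFieldType) (d : R) n : 0 <= d -> 1 + n%:R * d <= (1 + d) ^+ n.
Proof.
move=> d0; elim: n => [|n ih]; first by rewrite mul0r addr0.
rewrite exprS -natr1; have n0 : 0 <= n%:R * d * d by rewrite !mulr_ge0.
have := ler_wpM2l (_ : 0 <= 1 + d) ih; rewrite addr_ge0 // => /(_ isT).
by lra.
Qed.

(** A factor linear in the exponent cannot make up for a ratio [a / r = 1 + e] above 1. Bernoulli at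
    half the exponent gives [(1 + e) ^ (2 m) >= (m e) ^ 2], quadratic in [m]; the number [x] below
    is the threshold at which this wins. *)
Lemma pow2_le (R : realType) (a r : R) (d : nat) : 0 <= r ->
  (forall i, a ^+ (2 ^ i.+1)%N <= (d * 2 ^ i.+1).+1%:R * r ^+ (2 ^ i.+1)%N) -> a <= r.
Proof.
move=> r0 h; rewrite leNgt; apply/negP => ra.
have a0 : 0 < a by apply: le_lt_trans ra.
have [r00|rn0] := eqVneq r 0.
  have := h 0%N; rewrite r00 expr0n /= mulr0 leNgt.
  by rewrite exprn_gt0.
have rp : 0 < r by rewrite lt_def rn0.
have [e e0 ae] : exists2 e : R, 0 < e & a = r * (1 + e).
  exists (a / r - 1); first by rewrite subr_gt0 ltr_pdivlMr // mul1r.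
  by rewrite addrC subrK mulrC divfK.
pose x := (2 * d%:R + 1) / e ^+ 2.
have x0 : 0 <= x by rewrite divr_ge0 ?exprn_ge0 ?(ltW e0) // addr_ge0 // mulr_ge0.
pose n := Num.bound x; pose m := (2 ^ n)%N.
have xm : x < m%:R.
  rewrite (lt_le_trans (archi_boundP x0)) // ler_nat; apply/ltnW.
  by rewrite /m /n ltn_expl.
have := h n; rewrite expnSr -/m ae exprMn mulrC ler_pM2r ?exprn_gt0 //.
apply/negP; rewrite -ltNge exprM.
have b := bernoulli_ge m (ltW e0).
have m0 : 0 < (m%:R : R) by rewrite ltr0n expn_gt0.
have m1 : 1 <= (m%:R : R) by rewrite ler1n expn_gt0.
have me : 0 <= m%:R * e by rewrite mulr_ge0 // ltW.
apply: lt_le_trans (_ : _ < (m%:R * e) ^+ 2) _; last first.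
  rewrite ler_pXn2r // ?nnegrE ?exprn_ge0 // ?addr_ge0 ?(ltW e0) //.
  by apply: le_trans b; rewrite lerDr.
have e2 : 0 < e ^+ 2 by rewrite exprn_gt0.
have : (2 * d%:R + 1) < m%:R * e ^+ 2 by rewrite -ltr_pdivrMr.
rewrite -[(d * _).+1%:R]natr1 !natrM exprMn.
by rewrite -(ltr_pM2l m0) => H; lra.
Qed.

(** * Central multipliers and averages of powers of a central unitary *)

Section CentralMultipliers.
Variables (R : realType) (B : cstarAlgType R).
Implicit Types (m n w : multiplier B) (x y : B).

Definition central m := mult_l m =1 mult_r m.
Definition contractive m := forall x, nrm (mult_l m x) <= nrm x.
Definition unitary m := m^# ** m = mult1 /\ m ** m^# = mult1.

Lemma central_MlM m x y : central m -> mult_l m (x ** y) = x ** mult_l m y.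
Proof. by move=> cm; rewrite cm mult_rM -cm. Qed.

Lemma centralC m n : central m -> central n -> m ** n = n ** m.
Proof.
move=> cm cn; have h x : mult_l m (mult_l n x) = mult_l n (mult_l m x).
  apply: smul_injr => y; transitivity (mult_l m x ** mult_l n y).
    by rewrite -(mult_lM m) -(mult_lM n) (central_MlM _ _ cn) mult_lM.
  by rewrite -[in RHS](mult_lM n) (central_MlM _ _ cn).
by apply: multP => x /=; [exact: h | rewrite -cm -cn -cn -cm h].
Qed.

Lemma central1 : central (mult1 : multiplier B). Proof. by []. Qed.
Lemma central0 : central (0 : multiplier B). Proof. by []. Qed.
Lemma centralD m n : central m -> central n -> central (m + n).
Proof. by move=> cm cn x /=; rewrite cm cn. Qed.
Lemma centralZ (c : R[i]) m : central m -> central (c *: m).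
Proof. by move=> cm x /=; rewrite cm. Qed.
Lemma centralM m n : central m -> central n -> central (m ** n).
Proof. by move=> cm cn x; rewrite [in LHS](centralC cm cn) /= -cm -cn. Qed.
Lemma centralJ m : central m -> central m^#.
Proof. by move=> cm x /=; rewrite cm. Qed.

Lemma central_mulM m n x y : central m -> central n ->
  mult_l m x ** mult_l n y = mult_l (m ** n) (x ** y).
Proof. by move=> cm cn; rewrite -mult_lM -central_MlM. Qed.

Lemma central_adj m x : central m -> (mult_l m x)^# = mult_l m^# x^#.
Proof. by move=> cm; rewrite /= -cm adjK. Qed.

Lemma central_nrmJ m x : central m -> nrm (mult_l m^# x) = nrm (mult_l m x).
Proof.
move=> cm; have cj := centralJ cm; apply/eqP.
rewrite -(eqrXn2 (n := 2)) ?nrm_ge0 // -!nrm_adjM !central_adj // adjK.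
by rewrite !central_mulM // centralC.
Qed.

(** A central [m] is normal, so [m] and [m^#] give vectors of equal norm; one factor [m] can be
    replaced by [m^#], and the C*-identity applies. *)
Lemma central_nrm_sq m x : central m ->
  nrm (mult_l (m ** m) (x^# ** x)) = nrm (mult_l m x) ^+ 2.
Proof.
move=> cm; have cj := centralJ cm.
by rewrite mult_lA -central_nrmJ // -mult_lA -nrm_adjM central_adj // central_mulM.
Qed.

Lemma contractiveM m n : contractive m -> contractive n -> contractive (m ** n).
Proof. by move=> cm cn x; rewrite mult_lA (le_trans (cm _)). Qed.

Lemma unitary_nrm w x : unitary w -> nrm (mult_l w x) = nrm x.
Proof. by case=> h _; exact: nrm_isom. Qed.
Lemma unitaryJ w : unitary w -> unitary w^#.
Proof. by case=> h1 h2; rewrite /unitary adjK. Qed.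
Lemma unitaryZ (c : R[i]) w : nrm c = 1 -> unitary w -> unitary (c *: w).
Proof.
move=> c1 [h1 h2]; have cc : c * (c^*)%R = 1 by rewrite -normCK nrmE c1 expr1n.
by split; rewrite adjZ smulZl smulZr scalerA ?[_^* * _]mulrC cc scale1r.
Qed.

Definition mpow w k : multiplier B := iter k (smul w) mult1.
(** [K] is a list of exponents with multiplicity, so that a product of two averages is again one,
    over the [sumset]. *)
Definition mavg (K : seq nat) w : multiplier B :=
  ((size K)%:R^-1 : R[i]) *: \sum_(k <- K) mpow w k.
Definition sumset (K K' : seq nat) := [seq (k + k')%N | k <- K, k' <- K'].

Lemma mpowD w j k : mpow w (j + k) = mpow w j ** mpow w k.
Proof.
by elim: j => [|j ih]; rewrite ?mult1m // addSn /= -/(mpow w _) ih smulA.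
Qed.

Lemma mpowZ (c : R[i]) w k : mpow (c *: w) k = c ^+ k *: mpow w k.
Proof.
elim: k => [|k ih]; first by rewrite expr0 scale1r.
by rewrite /= -/(mpow _ _) ih smulZl smulZr scalerA exprS.
Qed.

Lemma central_mpow w k : central w -> central (mpow w k).
Proof. by move=> cw; elim: k => // k ih; exact: centralM. Qed.

Lemma nrm_mpow w k x : unitary w -> nrm (mult_l (mpow w k) x) = nrm x.
Proof. by move=> uw; elim: k => // k ih; rewrite /= unitary_nrm. Qed.

Lemma mult_l_sum (I : Type) (r : seq I) (F : I -> multiplier B) x :
  mult_l (\sum_(i <- r) F i) x = \sum_(i <- r) mult_l (F i) x.
Proof. by elim: r => [|i r ih]; rewrite ?big_nil // !big_cons mult_lDm ih. Qed.

Lemma smul_suml (I : Type) (r : seq I) (F : I -> multiplier B) m :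
  (\sum_(i <- r) F i) ** m = \sum_(i <- r) F i ** m.
Proof. by elim: r => [|i r ih]; rewrite ?big_nil ?smul0r // !big_cons smulDl ih. Qed.
Lemma smul_sumr (I : Type) (r : seq I) (F : I -> multiplier B) m :
  m ** (\sum_(i <- r) F i) = \sum_(i <- r) m ** F i.
Proof. by elim: r => [|i r ih]; rewrite ?big_nil ?smulr0 // !big_cons smulDr ih. Qed.

Lemma mavgM (K K' : seq nat) w : mavg K w ** mavg K' w = mavg (sumset K K') w.
Proof.
rewrite /mavg smulZl smulZr scalerA size_allpairs natrM invfM; congr (_ *: _).
rewrite /sumset big_allpairs_dep smul_suml; apply: eq_bigr => k _.
by rewrite smul_sumr; apply: eq_bigr => k' _; rewrite mpowD.
Qed.

Lemma central_mavg (K : seq nat) w : central w -> central (mavg K w).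
Proof.
move=> cw; apply: centralZ; apply: big_ind => [|m n|k _].
- exact: central0.
- exact: centralD.
- exact: central_mpow.
Qed.

Lemma nrm_natV (n : nat) : nrm (n%:R^-1 : R[i]) = n%:R^-1.
Proof.
by rewrite -(rmorph_nat (real_complex R)) -fmorphV nrmC ger0_norm.
Qed.

Lemma mavg_contr (K : seq nat) w : unitary w -> contractive (mavg K w).
Proof.
move=> uw x; rewrite mult_lZm nrmZ nrm_natV.
have [->|K0] := eqVneq (size K) 0%N; first by rewrite invr0 mul0r nrm_ge0.
rewrite ler_pdivrMl ?ltr0n ?lt0n // mult_l_sum (le_trans (nrm_sum _ _)) //.
under eq_bigr do rewrite nrm_mpow //.
by rewrite big_const_seq count_predT iter_addr_0 mulr_natl.
Qed.

Lemma sum_scale_pick (K : seq nat) (j : nat) (c : R[i]) (F : nat -> B) :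
  \sum_(k <- K) (if k == j then c else 0) *: F k = (c * (count_mem j K)%:R) *: F j.
Proof.
elim: K => [|k K ih]; first by rewrite big_nil mulr0 scale0r.
rewrite big_cons ih /= natrD mulrDr scalerDl; congr (_ + _).
by case: eqP => [->|_]; rewrite ?mulr1 // mulr0 !scale0r.
Qed.

Lemma sum_count_mem (K : seq nat) N : (forall k, k \in K -> (k <= N)%N) ->
  (\sum_(j < N.+1) count_mem (val j) K)%N = size K.
Proof.
elim: K => [|k K ih] KN; first by rewrite big1.
rewrite /= big_split /= ih => [|k' k'K]; last by rewrite KN // inE k'K orbT.
rewrite (bigD1 (inord k)) //= inordK ?ltnS ?KN ?mem_head // eqxx.
rewrite big1 ?addn0 // => j jk; apply/eqP; rewrite eqb0.
by apply: contra jk => /eqP ->; rewrite inord_val.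
Qed.

(* The average of [lam ^- j * mavg K (lam z)] over the roots of unity [lam] of
   order [N.+1] is the term of [mavg K z] in [z ^ j]. *)
Lemma mavg_coef (K : seq nat) z y N (s : R) : unitary z ->
  (forall k, k \in K -> (k <= N)%N) -> (0 < size K)%N ->
  (forall lam : R[i], nrm lam = 1 -> nrm (mult_l (mavg K (lam *: z)) y) <= s) ->
  nrm y <= N.+1%:R * s.
Proof.
move=> uz KN K0 hs.
have [w wP] := numClosed_prim_root R[i] (ltn0Sn N).
have nX (a : R[i]) e : nrm (a ^+ e) = nrm a ^+ e.
  by elim: e => [|e ih]; rewrite ?expr0 /nrm ?normr1 // !exprS -/(nrm _) nrmM ih.
have w1 : nrm w = 1.
  have : nrm w ^+ N.+1 == 1 ^+ N.+1.
    by rewrite expr1n -nX (prim_expr_order wP) /nrm normr1.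
  by rewrite eqrXn2 ?nrm_ge0 // => /eqP.
have wk k : nrm (w ^+ k) = 1 by rewrite nX w1 expr1n.
have sK : 0 < (size K)%:R :> R by rewrite ltr0n.
have coef j : (j <= N)%N -> (count_mem j K)%:R * nrm y <= (size K)%:R * s.
  move=> jN.
  (* The exponent [N.+1 - j] stands for [- j], since [w] has order [N.+1]. *)
  pose S := \sum_(t < N.+1) (w ^+ (N.+1 - j)) ^+ t *: mult_l (mavg K (w ^+ t *: z)) y.
  have SE : S = ((size K)%:R^-1 * (N.+1%:R * (count_mem j K)%:R) : R[i]) *: mult_l (mpow z j) y.
    rewrite -scalerA -(sum_scale_pick _ _ _ (fun k => mult_l (mpow z k) y)) /S.
    transitivity ((size K)%:R^-1 *: \sum_(t < N.+1) \sum_(k <- K)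
        (w ^+ (N.+1 - j + k)) ^+ t *: mult_l (mpow z k) y).
      rewrite scaler_sumr; apply: eq_bigr => t _.
      rewrite mult_lZm mult_l_sum scalerA mulrC -scalerA; congr (_ *: _).
      rewrite scaler_sumr; apply: eq_bigr => k _.
      by rewrite mpowZ mult_lZm scalerA -!exprM mulnC -exprD -mulnDr mulnC.
    congr (_ *: _); rewrite exchange_big /= big_seq [RHS]big_seq.
    apply: eq_bigr => k kK; rewrite -scaler_suml (prim_root_sum _ wP).
    have kN := KN _ kK.
    suff -> : (N.+1 %| N.+1 - j + k)%N = (k == j) by [].
    apply/idP/eqP => [|->]; last by rewrite subnK // ltnW.
    by move=> /dvdnP[[|[|q]]]; rewrite ?mul0n ?mul1n ?mulSn; lia.
  have : nrm S <= N.+1%:R * s.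
    apply: le_trans (nrm_sum _ _) _.
    have -> : N.+1%:R * s = \sum_(t < N.+1) s by rewrite sumr_const card_ord mulr_natl.
    by apply: ler_sum => t _; rewrite nrmZ1 ?hs // nX wk expr1n.
  rewrite SE nrmZ nrmM nrm_natV nrm_mpow // -natrM -(rmorph_nat (real_complex R)) nrmC.
  rewrite ger0_norm ?ler0n // natrM -mulrA ler_pdivrMl //.
  rewrite -mulrA [leRHS]mulrCA.
  by rewrite ler_pM2l // ltr0n.
(* Summing over all [j] avoids choosing one: the multiplicities add up to [size K], which then
   cancels. *)
have : \sum_(j < N.+1) (count_mem (val j) K)%:R * nrm y <= \sum_(j < N.+1) (size K)%:R * s.
  by apply: ler_sum => j _; rewrite coef // -ltnS ltn_ord.
rewrite -mulr_suml -natr_sum sum_count_mem // sumr_const card_ord -[leRHS]mulr_natl.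
by rewrite [leRHS]mulrCA ler_pM2l.
Qed.

(* If all these norms were at most [r], then for [e = 2 ^ i.+1] the C*-identity
   and [mavg_coef] would give [|x| ^ e <= (d e + 1) r ^ e], so [|x| <= r]. *)
Lemma mavg_peak (K : seq nat) z x (r : R) : central z -> unitary z ->
  (0 < size K)%N -> 0 <= r -> r < nrm x ->
  exists2 lam : R[i], nrm lam = 1 & r < nrm (mult_l (mavg K (lam *: z)) x).
Proof.
move=> cz uz K0 r0 rx; apply/not_exists2P => h.
have {}h (lam : R[i]) : nrm lam = 1 -> nrm (mult_l (mavg K (lam *: z)) x) <= r.
  by move=> l1; rewrite leNgt; apply/negP => l2; case: (h lam).
pose d := \max_(k <- K) k.
(* [Ks i] is the sumset of [2 ^ i.+1] copies of [K], and [ys i] is the power [2 ^ i] of [x^# ** x].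
   The average over [Ks i] is the matching power of the average over [K]. *)
pose Ks := fix Ks i := if i is i'.+1 then sumset (Ks i') (Ks i') else sumset K K.
pose ys := fix ys i := if i is i'.+1 then ys i' ** ys i' else x^# ** x.
have ysJ i : (ys i)^# = ys i.
  by elim: i => [|i ih] /=; rewrite adjM ?adjK ?ih.
have ysn i : nrm (ys i) = nrm x ^+ (2 ^ i.+1)%N.
  elim: i => [|i ih]; first by rewrite /= nrm_adjM.
  by rewrite /= -[X in X ** _]ysJ nrm_adjM ih -exprM -expnSr.
have Ks0 i : (0 < size (Ks i))%N.
  by elim: i => [|i ih] /=; rewrite size_allpairs muln_gt0 ?K0 ?ih.
have Ksd i k : k \in Ks i -> (k <= d * 2 ^ i.+1)%N.
  elim: i k => [|i ih] k /= /allpairsP[[a b] /= [ha hb ->]].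
    by rewrite muln2 -addnn leq_add // /d leq_bigmax_seq.
  by rewrite expnSr mulnA muln2 -addnn leq_add // ih.
have hK i (lam : R[i]) : nrm lam = 1 ->
    nrm (mult_l (mavg (Ks i) (lam *: z)) (ys i)) <= r ^+ (2 ^ i.+1)%N.
  move=> l1; have cl : central (lam *: z) by exact: centralZ.
  elim: i => [|i ih].
    rewrite -[Ks 0%N]/(sumset K K) -[ys 0%N]/(x^# ** x) -mavgM central_nrm_sq; last exact: central_mavg.
    by rewrite ler_pXn2r // ?nnegrE ?nrm_ge0 // h.
  rewrite -[Ks i.+1]/(sumset (Ks i) (Ks i)) -[ys i.+1]/(ys i ** ys i) -mavgM.
  rewrite -central_mulM; [|exact: central_mavg..].
  rewrite (le_trans (nrm_smul _ _)) // expnSr exprM expr2.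
  by rewrite ler_pM ?nrm_ge0.
suff /(pow2_le r0) : forall i,
    nrm x ^+ (2 ^ i.+1)%N <= (d * 2 ^ i.+1).+1%:R * r ^+ (2 ^ i.+1)%N.
  by rewrite leNgt rx.
move=> i; rewrite -ysn; apply: (mavg_coef uz _ _ (hK i)) => //.
exact: Ksd.
Qed.

End CentralMultipliers.

(** The finite intersection property, arranged for index types with a join: lists under
    concatenation or numbers under [maxn]. Several later compactness arguments take this form. *)
Lemma compact_directed (X : topologicalType) (K : set X) (L : Type) (l0 : L)
    (C : L -> set X) : compact K -> (forall l, closed (C l)) ->
  (forall l, (K `&` C l) !=set0) ->
  (forall l l', exists l'', K `&` C l'' `<=` C l `&` C l') ->
  exists2 x, K x & forall l, C l x.
Proof.
move=> cK cC ne dir; pose F := filter_from setT (fun l => K `&` C l).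
have FF : ProperFilter F.
  apply: filter_from_proper => [|l _]; last exact: ne.
  apply: filter_from_filter; first by exists l0.
  move=> l l' _ _; have [l'' hl] := dir l l'; exists l'' => // x [Kx Cx].
  by have [] := hl x (conj Kx Cx).
have FK : F K by exists l0 => // x [].
have [x [Kx Fx]] := cK F FF FK; exists x => // l; apply: cC => U Ux.
have FC : F (C l) by exists l => // y [].
exact: Fx.
Qed.

Lemma nrm_continuousP (R : realType) (T : topologicalType) (V : normedModType R[i])
    (f : T -> V) : (forall x e, 0 < e -> \forall y \near x, nrm (f x - f y) < e) ->
  continuous f.
Proof. by move=> h x; apply: (proj2 (nrm_cvgP f (f x) _)) (h x). Qed.

Lemma ptws_near (K : numFieldType) (V : normedModType K) (I : eqType)
    (u : {ptws I -> V}) (i : I) (e : K) :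
  0 < e -> \forall v \near u, `|u i - v i| < e.
Proof.
move=> e0; have h : @proj I (fun=> V) i @ u --> u i by exact: (@proj_continuous I (fun=> V) i u).
move: h => /cvgrPdist_lt /(_ e e0) h.
exact (h (@nbhs_filter {ptws I -> V} u)).
Qed.
Lemma ptws_nrm_near (R : realType) (V : normedModType R[i]) (I : eqType)
    (u : {ptws I -> V}) (i : I) (e : R) :
  0 < e -> \forall v \near u, nrm (u i - v i) < e.
Proof.
move=> e0; have e0' : 0 < e%:C by rewrite ltcR.
apply: (@filterS _ _ (@nbhs_filter {ptws I -> V} u) _ _ _ (@ptws_near _ V I u i _ e0')) => v.
by rewrite nrmE ltcR.
Qed.

Section Circle.
Variable R : realType.

Definition circle : set (R[i]^o) := [set c | nrm c = 1].

Lemma nrm_continuous (V : normedModType R[i]) : continuous (@nrm R V : V -> R^o).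
Proof.
move=> x; apply/(@cvgrPdist_lt R R^o) => e e0.
have /nrm_cvgP /(_ _ e0) : id @ nbhs x --> (x : V) by [].
apply: filterS => y; apply: le_lt_trans.
rewrite ler_norml; apply/andP; split; last by rewrite lerBlDl nrm_le.
by rewrite lerNl opprB lerBlDl nrmB nrm_le.
Qed.

Lemma closed_nrm_eq (V : normedModType R[i]) (r : R) : closed [set x : V | nrm x = r].
Proof.
have -> : [set x : V | nrm x = r] = @nrm R V @^-1` [set r] by [].
by apply: closed_comp; [move=> x _; exact: nrm_continuous|exact: closed_eq].
Qed.

Lemma closed_nrm_ge (V : normedModType R[i]) (r : R) : closed [set x : V | r <= nrm x].
Proof.
have -> : [set x : V | r <= nrm x] = @nrm R V @^-1` [set s | r <= s] by [].
by apply: closed_comp; [move=> x _; exact: nrm_continuous|exact: closed_ge].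
Qed.

Lemma nrm_ge_Re (c : R[i]) : `|complex.Re c| <= nrm c.
Proof. by rewrite -lecR -nrmE normc_ge_Re. Qed.

Lemma nrm_ge_Im (c : R[i]) : `|complex.Im c| <= nrm c.
Proof.
have := nrm_ge_Re (c * 'i%C); rewrite nrmM.
have -> : nrm ('i%C : R[i]) = 1.
  by rewrite /nrm normc_def /= expr0n expr1n add0r sqrtr1.
by rewrite mulr1; case: c => a b; simpc; rewrite /= normrN.
Qed.

Lemma compact_circle : compact circle.
Proof.
(* The circle is a closed part of the image of the square [[-1, 1]^2], which is compact as a product
   indexed by [bool]. *)
pose f (u : {ptws bool -> R^o}) : R[i]^o := u true +i* u false.
have cf : continuous f.
  apply: (@nrm_continuousP R {ptws bool -> R^o} R[i]^o f) => u e e0.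
  have e2 : 0 < e / 2 by rewrite divr_gt0.
  pose hp b := @ptws_near R R^o bool u b (e / 2) e2.
  apply: (@filterS _ _ (@nbhs_filter {ptws bool -> R^o} u) _ _ _
    (@filterI _ _ (@nbhs_filter {ptws bool -> R^o} u) _ _ (hp true) (hp false))).
  move=> v [/= h1 h2].
  have -> : f u - f v = (u true - v true)%:C + 'i%C * (u false - v false)%:C.
    exact: complexE (f u - f v).
  rewrite (le_lt_trans (nrmD _ _)) // nrmM !nrmC.
  have -> : nrm ('i%C : R[i]) = 1.
    by rewrite /nrm normc_def /= expr0n expr1n add0r sqrtr1.
  by rewrite mul1r [e]splitr ltrD.
pose A := [set u : {ptws bool -> R^o} | forall b, `[(-1), 1]%classic (u b)].
have cA : compact A.
  by apply: (@tychonoff bool (fun=> R^o) (fun=> `[(-1), 1]%classic)) => _; exact: segment_compact.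
have cfA : compact (f @` A).
  by apply: continuous_compact cA; exact: continuous_subspaceT.
apply: (@subclosed_compact R[i]^o _ _ _ cfA); first exact: closed_nrm_eq.
move=> c /= c1; exists (fun b => if b then complex.Re c else complex.Im c).
  by case; rewrite /= in_itv /= -ler_norml -c1 ?nrm_ge_Re ?nrm_ge_Im.
by rewrite /f; case: c {c1}.
Qed.
End Circle.

(** * Joint localization at a family of central unitaries *)

Section Localization.
Variables (R : realType) (B : cstarAlgType R) (I : choiceType).
Variable z : I -> multiplier B.
Hypotheses (cz : forall i, central (z i)) (uz : forall i, unitary (z i)).
Implicit Types (lam : I -> R[i]) (l : seq (I * nat)) (x y b : B).

(* As [l] grows, [loc lam l] concentrates at the points of the joint spectrum
   where each [z i] equals [(lam i)^-1]. *)
Definition loc lam l : multiplier B :=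
  foldr (fun iN m => mavg (iota 0 iN.2.+1) (lam iN.1 *: z iN.1) ** m) mult1 l.

Lemma central_loc lam l : central (loc lam l).
Proof.
elim: l => [|iN l ih]; first exact: central1.
by apply: centralM ih; exact/central_mavg/centralZ.
Qed.

Lemma loc_contr lam l : (forall i, nrm (lam i) = 1) -> contractive (loc lam l).
Proof.
move=> h; elim: l => [|iN l ih] //.
by apply: contractiveM ih; exact/mavg_contr/unitaryZ.
Qed.

Lemma loc_cat lam l l' : loc lam (l ++ l') = loc lam l ** loc lam l'.
Proof. by elim: l => [|iN l ih]; rewrite /= ?mult1m // ih smulA. Qed.

Lemma loc_catC lam l l' : loc lam (l ++ l') = loc lam (l' ++ l).
Proof. by rewrite !loc_cat; apply: centralC; exact: central_loc. Qed.

Lemma loc_filter lam (p : pred (I * nat)) l :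
  loc lam l = loc lam (seq.filter (predC p) l ++ seq.filter p l).
Proof.
elim: l => //= iN l ih; case: (p iN) => /=; rewrite ih //.
by rewrite [in RHS]loc_catC /= loc_catC.
Qed.

Lemma eq_loc lam lam' l : (forall iN, iN \in l -> lam iN.1 = lam' iN.1) ->
  loc lam l = loc lam' l.
Proof.
elim: l => //= iN l ih h; rewrite h ?mem_head // ih // => jM jl.
by rewrite h // inE jl orbT.
Qed.

Lemma loc_key i l : (forall iN, iN \in l -> iN.1 = i) ->
  exists2 K, (0 < size K)%N & forall lam, loc lam l = mavg K (lam i *: z i).
Proof.
elim: l => [|iN l ih] h.
  exists [:: 0%N] => // mu; rewrite /mavg big_seq1 /= invr1.
  by rewrite scale1r.
have [|K K0 hK] := ih; first by move=> jM jl; rewrite h // inE jl orbT.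
exists (sumset (iota 0 iN.2.+1) K).
  by rewrite size_allpairs muln_gt0 K0.
by move=> mu; rewrite -mavgM -hK /= h // mem_head.
Qed.

(** [lam i] can be chosen only once, so all factors with the index of the head are gathered and
    merged by [loc_key] into one average, for which [mavg_peak] gives [lam i]. The induction goes on
    with the other factors and with the image of [b], whose norm still exceeds [r]. *)
Lemma loc_peak l b (r : R) : 0 <= r -> r < nrm b ->
  exists2 lam, (forall i, nrm (lam i) = 1) & r < nrm (mult_l (loc lam l) b).
Proof.
move=> r0; have [n] := ubnP (size l); elim: n l b => // n ih [|[i N] l] b ln rb.
  by exists (fun=> 1) => // i; rewrite /nrm normr1.
pose p := [pred jM : I * nat | jM.1 == i].
have [|K K0 hK] := @loc_key i (seq.filter p ((i, N) :: l)) _.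
  by move=> jM; rewrite mem_filter => /andP[/eqP].
have [mu mu1 hmu] := mavg_peak (cz i) (uz i) K0 r0 rb.
have [|lam' lam1' hlam'] := ih (seq.filter (predC p) ((i, N) :: l)) _ _ hmu.
  rewrite /= eqxx /=; apply: leq_ltn_trans (_ : size l < n)%N => //.
  by rewrite size_filter count_size.
exists (fun j => if j == i then mu else lam' j) => [j|].
  by case: eqP => // _.
rewrite (loc_filter _ p) loc_cat mult_lA hK eqxx.
rewrite (@eq_loc _ lam') // => jM; rewrite mem_filter => /andP[/= /negbTE ->] //.
Qed.

Lemma loc_continuous (X : topologicalType) (ev : X -> I -> R[i]) l b :
  (forall i, continuous (fun t => ev t i : R[i]^o)) ->
  continuous (fun t => mult_l (loc (ev t) l) b).
Proof.
move=> cev; elim: l => [|[i N] l ih]; first exact: cst_continuous.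
have hp k (g : X -> B) : continuous g ->
    continuous (fun t => mult_l (mpow (ev t i *: z i) k) (g t)).
  move=> cg; elim: k => // k ihk t.
  apply: (@cvgZ R[i] B X (nbhs t) _ (fun t => ev t i)
    (fun t => mult_l (z i) (mult_l (mpow (ev t i *: z i) k) (g t)))); first exact: cev.
  apply: (proj2 (nrm_cvgP _ _ _)) => e e0.
  have /(proj1 (nrm_cvgP _ _ _))/(_ _ e0) := ihk t.
  by apply: filterS => y; rewrite -mult_lB unitary_nrm.
move=> t; apply: (@cvgZ R[i] B X (nbhs t) _ (cst _)
  (fun t => mult_l (\sum_(k <- iota 0 N.+1) mpow (ev t i *: z i) k)
    (mult_l (loc (ev t) l) b))); first exact: cvg_cst.
under eq_fun do rewrite mult_l_sum; rewrite mult_l_sum.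
by apply: cvg_big => [|k _]; [exact: add_continuous|exact: hp].
Qed.

Lemma loc_exists b (r : R) : 0 <= r -> r < nrm b ->
  exists2 lam, (forall i, nrm (lam i) = 1) & forall l, r <= nrm (mult_l (loc lam l) b).
Proof.
move=> r0 rb; pose X : topologicalType := {ptws I -> R[i]^o}.
pose K : set X := [set lam : X | forall i, circle (lam i)].
pose C l : set X := [set lam : X | r <= nrm (mult_l (loc lam l) b)].
have cK : compact K.
  by apply: (@tychonoff I (fun=> R[i]^o) (fun=> @circle R)) => _; exact: compact_circle.
have Cc l : closed (C l).
  have -> : C l = (fun lam : X => mult_l (loc lam l) b) @^-1` [set x | r <= nrm x] by [].
  apply: closed_comp => [lam _|].
    apply: (@loc_continuous X id) => i; exact: (@proj_continuous I (fun=> R[i]^o) i).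
  exact: closed_nrm_ge.
have [|l l'|lam lamK lamC] := compact_directed [::] cK Cc.
- by move=> l; have [lam h1 /ltW h2] := loc_peak l r0 rb; exists lam.
(* Extra factors are contractions, so a lower bound for the longer list passes to each part. *)
- exists (l ++ l') => lam [lamK]; rewrite /C /= => h.
  split; apply: le_trans h _; last by rewrite loc_cat; exact: loc_contr.
  by rewrite loc_catC loc_cat; exact: loc_contr.
- by exists lam.
Qed.

Section LocSeminorm.
Variable lam : I -> R[i].
Hypothesis lam1 : forall i, nrm (lam i) = 1.

Let S x : set R := [set nrm (mult_l (loc lam l) x) | l in setT].
Let S_inf x : has_inf (S x).
Proof.
split; first by exists (nrm x), [::].
by exists 0 => _ [l _ <-]; exact: nrm_ge0.
Qed.
(** Appending factors decreases the norm, so this infimum is the limit of a decreasing net; two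
    near-optimal lists are merged by concatenation. *)
Definition locn x : R := inf (S x).

Lemma locn_le l x : locn x <= nrm (mult_l (loc lam l) x).
Proof. by apply: ge_inf; [exact: (S_inf x).2|exists l]. Qed.

Lemma locn_ge (c : R) x : (forall l, c <= nrm (mult_l (loc lam l) x)) -> c <= locn x.
Proof. by move=> h; apply: lb_le_inf => [|_ [l _ <-]]; first exact: (S_inf x).1. Qed.

Lemma locn_near x (e : R) : 0 < e -> exists l, nrm (mult_l (loc lam l) x) < locn x + e.
Proof.
by move=> e0; have [_ [l _ <-] h] := inf_adherent e0 (S_inf x); exists l.
Qed.

Lemma loc_catl l l' x : nrm (mult_l (loc lam (l ++ l')) x) <= nrm (mult_l (loc lam l) x).
Proof. by rewrite loc_catC loc_cat; exact: loc_contr. Qed.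
Lemma loc_catr l l' x : nrm (mult_l (loc lam (l ++ l')) x) <= nrm (mult_l (loc lam l') x).
Proof. by rewrite loc_cat; exact: loc_contr. Qed.

Fact locn_ge0 x : 0 <= locn x.
Proof. by apply: locn_ge => l; exact: nrm_ge0. Qed.

Fact locnD x y : locn (x + y) <= locn x + locn y.
Proof.
apply/ler_addgt0Pr => e e0; have e2 : 0 < e / 2 by rewrite divr_gt0.
have [[l /ltW hl] [l' /ltW hl']] := (locn_near x e2, locn_near y e2).
rewrite (le_trans (locn_le (l ++ l') _)) // mult_lD (le_trans (nrmD _ _)) //.
rewrite [e]splitr addrACA lerD //.
  exact: le_trans (loc_catl _ _ _) hl.
exact: le_trans (loc_catr _ _ _) hl'.
Qed.

Fact locnZ (c : R[i]) x : locn (c *: x) = nrm c * locn x.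
Proof.
have h l : nrm (mult_l (loc lam l) (c *: x)) = nrm c * nrm (mult_l (loc lam l) x).
  by rewrite mult_lZ nrmZ.
apply/le_anti/andP; split.
  have [c0|c0] := eqVneq (nrm c) 0.
    by rewrite c0 mul0r (le_trans (locn_le [::] _)) // h c0 mul0r.
  have cp : 0 < nrm c by rewrite lt_def c0 nrm_ge0.
  rewrite mulrC -ler_pdivrMr //; apply: locn_ge => l.
  by rewrite ler_pdivrMr // mulrC -h locn_le.
by apply: locn_ge => l; rewrite h ler_wpM2l ?nrm_ge0 ?locn_le.
Qed.

Fact locn_nrm x : locn x <= nrm x. Proof. exact: (locn_le [::]). Qed.

Fact locnM x y : locn (x ** y) <= locn x * locn y.
Proof.
(* Centrality distributes the factors over [x] and [y]. The infimum is then taken first in [l'] and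
   next in [l]; the division involved is why zero factors are treated apart. *)
have key l l' : locn (x ** y) <= nrm (mult_l (loc lam l) x) * nrm (mult_l (loc lam l') y).
  rewrite (le_trans (locn_le (l ++ l') _)) // loc_cat -central_mulM ?nrm_smul //.
  - exact: central_loc.
  - exact: central_loc.
have key2 l : locn (x ** y) <= nrm (mult_l (loc lam l) x) * locn y.
  set a := nrm _; have [a0|a0] := eqVneq a 0.
    by have := key l [::]; rewrite -/a a0 !mul0r.
  have ap : 0 < a by rewrite lt_def a0 nrm_ge0.
  by rewrite mulrC -ler_pdivrMr //; apply: locn_ge => l'; rewrite ler_pdivrMr // mulrC; exact: key.
have [a0|a0] := eqVneq (locn y) 0.
  by have := key2 [::]; rewrite a0 !mulr0.
have ap : 0 < locn y by rewrite lt_def a0 locn_ge0.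
by rewrite -ler_pdivrMr //; apply: locn_ge => l'; rewrite ler_pdivrMr; first exact: key2.
Qed.

Fact locnJM x : locn (x^# ** x) = locn x ^+ 2.
Proof.
apply/le_anti/andP; split; last first.
  apply: locn_ge => l; have cl := central_loc lam l.
  rewrite (le_trans (_ : _ <= nrm (mult_l (loc lam l) x) ^+ 2)) //.
    by rewrite ler_pXn2r ?nnegrE ?locn_ge0 ?nrm_ge0 // locn_le.
  by rewrite -central_nrm_sq // mult_lA loc_contr.
apply/ler_addgt0Pr => e e0.
(* As [d <= 1], [(locn x + d) ^+ 2] exceeds [locn x ^+ 2] by at most [d * (2 * locn x + 1) <= e]. *)
pose d := Num.min 1 (e / (2 * locn x + 1)).
have n0 := locn_ge0 x.
have t0 : 0 < 2 * locn x + 1 by lra.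
have d0 : 0 < d by rewrite lt_min ltr01 divr_gt0.
have [l /ltW hl] := locn_near x d0.
rewrite (le_trans (locn_le (l ++ l) _)) // loc_cat central_nrm_sq; last exact: central_loc.
apply: le_trans (_ : (locn x + d) ^+ 2 <= _).
  by rewrite ler_pXn2r ?nnegrE ?addr_ge0 ?nrm_ge0 // ltW.
have d1 : d <= 1 by rewrite ge_min lexx.
have : d * (2 * locn x + 1) <= e by rewrite -ler_pdivlMr // ge_min lexx orbT.
by nra.
Qed.

(* [(1 + w + .. + w ^ N) (1 - w) = 1 - w ^ N.+1] with [w = lam i *: z i]. *)
Lemma locn_sub i x : locn (x - lam i *: mult_l (z i) x) = 0.
Proof.
apply/le_anti; rewrite locn_ge0 andbT; apply/ler_addgt0Pr => e e0; rewrite add0r.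
set w := lam i *: z i; have uw : unitary w by exact: unitaryZ.
pose N := Num.bound (2 * nrm x / e).
rewrite (le_trans (locn_le [:: (i, N)] _)) //.
have -> : loc lam [:: (i, N)] = mavg (iota 0 N.+1) w by exact: multm1.
rewrite mult_lZm nrmZ nrm_natV size_iota ler_pdivrMl ?ltr0n //.
have tele n : mult_l (\sum_(k <- iota 0 n) mpow w k) (x - mult_l w x)
    = x - mult_l (mpow w n) x.
  elim: n => [|n ih]; first by rewrite big_nil subrr.
  have -> : iota 0 n.+1 = iota 0 n ++ [:: n] by rewrite -{1}[n.+1]addn1 iotaD.
  rewrite big_cat big_seq1 mult_lDm ih mult_lB addrA subrK -mult_lA.
  by congr (_ - mult_l _ x); rewrite -[n.+1]addn1 mpowD [mpow w 1]/= multm1.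
rewrite tele.
rewrite (le_trans (nrmD _ _)) // nrmN nrm_mpow //.
have -> : nrm x + nrm x = 2 * nrm x by lra.
rewrite -ler_pdivrMr // ltW // (lt_le_trans (archi_boundP _)) //.
  by apply: divr_ge0; [apply: mulr_ge0 => //; exact: nrm_ge0|exact: ltW].
by rewrite ler_nat.
Qed.

(** Modulo the kernel every [w] acts as the identity, hence so do its powers, their averages and
    products of averages. So [mult_l (loc lam l) x] is a lift of the class of [x], of norm close to
    [locn x] for suitable [l]: this is [csn_lift]. *)
Lemma locn_loc l x : locn (x - mult_l (loc lam l) x) = 0.
Proof.
have add0 u v : locn u = 0 -> locn v = 0 -> locn (u + v) = 0.
  move=> u0 v0; apply/le_anti; rewrite locn_ge0 andbT.
  by rewrite (le_trans (locnD _ _)) // u0 v0 addr0.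
elim: l x => [|[i N] l ih] x; first by rewrite subrr -(scale0r 0) locnZ nrm0 mul0r.
rewrite -[loc lam _]/(mavg (iota 0 N.+1) (lam i *: z i) ** loc lam l) mult_lA.
rewrite -[x - _](subrKA (mult_l (loc lam l) x)); apply: (add0); first exact: ih.
set y := mult_l _ x; set w := lam i *: z i; set K := iota _ _.
have -> : y - mult_l (mavg K w) y
    = (size K)%:R^-1 *: \sum_(k <- K) (y - mult_l (mpow w k) y).
  rewrite sumrB scalerBr mult_lZm mult_l_sum; congr (_ - _).
  rewrite big_const_seq count_predT iter_addr_0 -[y *+ _]scaler_nat scalerA.
  by rewrite mulVf ?scale1r // pnatr_eq0 size_iota.
rewrite locnZ; apply/eqP; rewrite mulf_eq0; apply/orP; right; apply/eqP.
apply: (big_ind (fun u => locn u = 0)) => [||k _].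
- by rewrite -(scale0r 0) locnZ nrm0 mul0r.
- exact: add0.
elim: k => [|k ihk]; first by rewrite subrr -(scale0r 0) locnZ nrm0 mul0r.
rewrite -[y - _](subrKA (mult_l (mpow w k) y)); apply: (add0) => //.
exact: locn_sub.
Qed.

Fact locn_lift x e : 0 < e -> exists2 y, locn (x - y) = 0 & nrm y <= locn x + e.
Proof.
by move=> /(locn_near x)[l /ltW hl]; exists (mult_l (loc lam l) x) => //; exact: locn_loc.
Qed.

Definition loc_seminorm : cstar_seminorm B :=
  CStarSeminorm locnD locnZ locnM locnJM locn_nrm locn_lift.
End LocSeminorm.

Lemma localization b (r : R) : 0 <= r -> r < nrm b ->
  exists (lam : I -> R[i]) (p : cstar_seminorm B),
    [/\ forall i, nrm (lam i) = 1,
        forall i x, p (x - lam i *: mult_l (z i) x) = 0 & r <= p b].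
Proof.
move=> r0 rb; have [lam lam1 h] := loc_exists r0 rb.
by exists lam, (loc_seminorm lam1); split=> // [i x|]; [exact: locn_sub|exact: locn_ge].
Qed.
End Localization.

(** * Extension of characters *)

Section CharacterExtension.
Variables (R : realType) (G : zmodType).
Implicit Types (X Y : set (G * R[i])) (s g : G) (c d : R[i]).

(* The graph of a character of a subgroup. *)
Record partial_char X : Prop := PartialChar {
  parchar0 : X (0, 1);
  parcharM : forall g h c d, X (g, c) -> X (h, d) -> X (g + h, c * d);
  parcharV : forall g c, X (g, c) -> X (- g, c^-1);
  parchar_inj : forall c, X (0, c) -> c = 1;
  parchar_norm : forall g c, X (g, c) -> `|c| = 1
}.

Lemma parcharX X g c n : partial_char X -> X (g, c) -> X (g *+ n, c ^+ n).
Proof.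
move=> pX gc; elim: n => [|n ih]; first exact: parchar0 pX.
by rewrite mulrS exprS; exact: parcharM.
Qed.

Lemma parcharXz X g c (k : int) : partial_char X -> X (g, c) -> X (g *~ k, c ^ k).
Proof.
move=> pX gc; case: k => n; first exact: parcharX.
by apply: (@parcharV _ pX (g *+ n.+1) (c ^+ n.+1)); exact: parcharX.
Qed.

Lemma parchar_fun X g c d : partial_char X -> X (g, c) -> X (g, d) -> c = d.
Proof.
move=> pX gc gd; have d0 : d != 0 by rewrite -normr_eq0 (parchar_norm pX gd) oner_neq0.
have := parcharM pX gc (parcharV pX gd); rewrite subrr => /(parchar_inj pX) cd.
by rewrite -[d]mul1r -cd divfK.
Qed.

(* The values [mu ^ k] are added at the multiples [k s]; [mu] is an [n]-th root
   of the value at [n s] for the least [n > 0] with [n s] in the domain, if any. *)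
Lemma parchar_adjoin X s : partial_char X ->
  exists Y, [/\ partial_char Y, X `<=` Y & exists c, Y (s, c)].
Proof.
move=> pX; pose D (n : nat) := `[< exists c, X (s *+ n, c) >].
have [mu mu1 muX] : exists2 mu : R[i], `|mu| = 1 &
    forall (k : int) c, X (s *~ k, c) -> c = mu ^ k.
  have [[n0 nD]|nD] := pselect (exists n, (0 < n)%N && D n); last first.
    (* No nonzero multiple of [s] lies in the domain, so any number of modulus one would be
       consistent. *)
    exists 1 => [|k c]; first exact: normr1.
    have [->|k0] := eqVneq k 0; first by rewrite mulr0z expr0z => /(parchar_inj pX).
    move=> kc; case: nD; exists `|k|%N; rewrite absz_gt0 k0 /=; apply/asboolP.
    have [kk|kk] := leP 0 k; first by exists c; rewrite pmulrn gez0_abs.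
    exists c^-1; rewrite pmulrn ltz0_abs // mulrNz; exact: parcharV.
  have exD : exists n, (0 < n)%N && D n by exists n0.
  case: (ex_minnP exD) => n /andP[n_gt0 /asboolP[c nc]] nmin.
  have cn : (n.-root c) ^+ n = c by exact: rootCK.
  exists (n.-root c) => [|k d kd].
    apply/eqP; rewrite -(pexpr_eq1 n_gt0) ?normr_ge0 // -normrX cn.
    by rewrite (parchar_norm pX nc).
  have kE := divz_eq k n; set q := (k %/ n)%Z in kE; set r := (k %% n)%Z in kE.
  have n0' : (n : int) != 0 by rewrite eqz_nat -lt0n.
  have r0 : 0 <= r by exact: modz_ge0.
  have rn : r < n by have := ltz_mod k n0'; rewrite ger0_norm.
  have qc : X (s *~ (q * n), c ^ q).
    by rewrite mulrC mulrzA; exact: parcharXz.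
  have rX : X (s *~ r, d / c ^ q).
    have -> : s *~ r = s *~ k - s *~ (q * n) by rewrite -mulrzBr kE addrAC subrr add0r.
    exact: parcharM pX _ _ _ _ kd (parcharV pX qc).
  (* The remainder gives a multiple [r s] in the domain with [r < n], so minimality of [n] forces it
     to vanish. *)
  have r00 : r = 0.
    apply/eqP/contraT => rn0; have := nmin `|r|%N.
    rewrite absz_gt0 rn0 /= leqNgt => /(_ _)/negP; case; last first.
      by rewrite -ltz_nat gez0_abs.
    by apply/asboolP; exists (d / c ^ q); rewrite pmulrn gez0_abs.
  rewrite kE r00 addr0 in kd *; rewrite (parchar_fun pX kd qc).
  by rewrite mulrC -exprz_exp -exprnP cn.
have mu0 : mu != 0 by rewrite -normr_eq0 mu1 oner_neq0.
have muk k : `|mu ^ k| = 1.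
  by case: k => n; rewrite ?NegzE -?exprnN ?normfV normrX mu1 expr1n ?invr1.
pose Y := [set u : G * R[i] | exists g c (k : int),
  X (g, c) /\ u = (g + s *~ k, c * mu ^ k)].
exists Y; split; last 1 first.
- by exists mu, 0, 1, 1; split; [exact: parchar0|rewrite add0r mul1r].
- split.
  + by exists 0, 1, 0; split; [exact: parchar0|rewrite mulr0z addr0 expr0z mulr1].
  + move=> _ _ _ _ [g [c [k [gc [-> ->]]]]] [h [d [j [hd [-> ->]]]]].
    exists (g + h), (c * d), (k + j); split; first exact: parcharM.
    by rewrite mulrzDr expfzDr // addrACA mulrACA.
  + move=> _ _ [g [c [k [gc [-> ->]]]]].
    exists (- g), c^-1, (- k); split; first exact: parcharV.
    by rewrite mulrNz opprD -invr_expz invfM.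
  + move=> _ [g [c [k [gc [/eqP + ->]]]]]; rewrite eq_sym addr_eq0 => /eqP gk.
    have := parcharV pX gc; rewrite gk opprK => /muX <-.
    by rewrite mulfV // -normr_eq0 (parchar_norm pX gc) oner_neq0.
  + move=> _ _ [g [c [k [gc [_ ->]]]]].
    by rewrite normrM muk (parchar_norm pX gc) mulr1.
- move=> [g c] gc; exists g, c, 0; split => //.
  by rewrite mulr0z addr0 expr0z mulr1.
Qed.

Lemma parchar_extend X : partial_char X ->
  exists xi : dual_group R G, forall g c, X (g, c) -> xi g = c.
Proof.
(* Adding [X] inside the property covers the empty chain, whose union is empty. *)
move=> pX; pose P Y := partial_char (X `|` Y).
have [F FP Ftot|A [PA Amax]] := @Zorn_bigcup _ P.
  have up u v : (X `|` \bigcup_(Y in F) Y) u -> (X `|` \bigcup_(Y in F) Y) v ->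
      exists Z, [/\ partial_char Z, Z `<=` X `|` \bigcup_(Y in F) Y, Z u & Z v].
    have sub Y : F Y -> X `|` Y `<=` X `|` \bigcup_(Y in F) Y.
      by move=> FY w [Xw|Yw]; [left|right; exists Y].
    move=> [Xu|[Y FY Yu]] [Xv|[Y' FY' Yv]].
    - by exists X; split=> // w; left.
    - by exists (X `|` Y'); split; [exact: FP|exact: sub|left|right].
    - by exists (X `|` Y); split; [exact: FP|exact: sub|right|left].
    - have [YY'|Y'Y] := Ftot _ _ FY FY'.
        by exists (X `|` Y'); split; [exact: FP|exact: sub|right; exact: YY'|right].
      by exists (X `|` Y); split; [exact: FP|exact: sub|right|right; exact: Y'Y].
  split.
  - by left; exact: parchar0.
  - move=> g h c d /up h1 /h1[Z [pZ ZX Zg Zh]]; apply: ZX; exact: parcharM.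
  - move=> g c gc; have [Z [pZ ZX Zg _]] := up _ _ gc gc; apply: ZX; exact: parcharV.
  - move=> c gc; have [Z [pZ ZX Zg _]] := up _ _ gc gc; exact: parchar_inj pZ _ Zg.
  - move=> g c gc; have [Z [pZ ZX Zg _]] := up _ _ gc gc; exact: parchar_norm pZ _ _ Zg.
have tot s : exists c, (X `|` A) (s, c).
  have [Y [pY XAY [c sc]]] := parchar_adjoin s PA.
  exists c; have XY : X `|` Y = Y.
    by apply/seteqP; split=> [w [Xw|//]|w]; [apply: XAY; left|right].
  have [//|nsc] := pselect ((X `|` A) (s, c)).
  case: (Amax Y); last by rewrite /P XY.
  split; first by move=> w Aw; apply: XAY; right.
  by move=> YA; apply: nsc; right; exact: YA.
have [f hf] := choice tot.
have fD s t : f (s + t) = f s * f t.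
  exact: parchar_fun PA (hf _) (parcharM PA (hf _) (hf _)).
exists (@Character R G f fD (fun s => parchar_norm PA (hf s))) => g c gc /=.
by apply: parchar_fun PA (hf g) _; left.
Qed.
End CharacterExtension.

Lemma char_extend (R : realType) (G : zmodType) (H : zmodClosed G) (f : G -> R[i]) :
  {in H &, forall h k, f (h + k) = f h * f k} -> {in H, forall h, `|f h| = 1} ->
  exists xi : dual_group R G, {in H, xi =1 f}.
Proof.
move=> fD f1; pose X := [set u : G * R[i] | u.1 \in H /\ u.2 = f u.1].
have H0 : (0 : G) \in H by exact: rpred0.
have f_neq0 h : h \in H -> f h != 0 by move=> hH; rewrite -normr_eq0 f1 ?oner_neq0.
have f0 : f 0 = 1.
  by apply: (mulfI (f_neq0 _ H0)); rewrite -fD // addr0 mulr1.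
have [|xi h] := @parchar_extend R G X.
  split.
  - by split.
  - by move=> g h c d [/= gH ->] [/= hH ->]; split; rewrite /= ?rpredD ?fD.
  - move=> g c [/= gH ->]; split; rewrite /= ?rpredN //.
    by apply: (mulfI (f_neq0 _ gH)); rewrite mulfV ?f_neq0 // -fD ?rpredN // subrr f0.
  - by move=> c [_ /= ->].
  - by move=> g c [/= gH ->]; exact: f1.
by exists xi => g gH; apply: h.
Qed.

(** * Isometry *)

Lemma dense_span_ext (R : realType) (V W : normedModType R[i]) (S : set V)
    (f g : V -> W) (C : R) : dense (lin_span S) ->
  (forall c a b, f (c *: a + b) = c *: f a + f b) ->
  (forall c a b, g (c *: a + b) = c *: g a + g b) ->
  (forall x, nrm (f x) <= C * nrm x) -> (forall x, nrm (g x) <= C * nrm x) ->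
  {in S, f =1 g} -> f =1 g.
Proof.
move=> dS fP gP fC gC fg x.
have lin0 (h : V -> W) : (forall c a b, h (c *: a + b) = c *: h a + h b) -> h 0 = 0.
  move=> hP; apply: (addrI (h 0)).
  by rewrite addr0; have := hP 1 0 0; rewrite !scale1r !addr0 => <-.
have span y : lin_span S y -> f y = g y.
  move=> [n [c [w [wS ->]]]]; elim: n c w wS => [|n ih] c w wS.
    by rewrite !big_ord0 !lin0.
  rewrite !big_ord_recl fP gP fg ?inE // ih // => i; exact: wS.
have sub (h : V -> W) a b : (forall c a b, h (c *: a + b) = c *: h a + h b) ->
    h (a - b) = h a - h b.
  by move=> hP; rewrite addrC -scaleN1r hP scaleN1r addrC.
apply/eqP; rewrite -subr_eq0; apply/eqP/nrm_small => e e0.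
have C0 : 0 < `|C| + 1 by rewrite ltr_wpDl.
have [y Sy xy] := nrm_denseP dS x (divr_gt0 (divr_gt0 e0 (ltr0Sn _ 1)) C0).
have -> : f x - g x = f (x - y) - g (x - y).
  by rewrite !sub // (span _ Sy) opprB addrA subrK.
have bd (u : V) : C * nrm u <= (`|C| + 1) * nrm u.
  by rewrite ler_wpM2r ?nrm_ge0 // (le_trans (ler_norm _)) // lerDl.
rewrite (le_trans (nrmD _ _)) // nrmN.
have : (`|C| + 1) * nrm (x - y) <= e / 2 by rewrite mulrC -ler_pdivlMr // ltW.
by have := bd (x - y); have := fC (x - y); have := gC (x - y); lra.
Qed.

Section CovariantFacts.
Variables (R : realType) (B : cstarAlgType R).
Implicit Types (m u : multiplier B) (x : B).

Lemma mult_of_l m x : mult_of (mult_l m x) = m ** mult_of x.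
Proof. by apply: multP => y /=; rewrite ?mult_lM ?mult_lr. Qed.
Lemma mult_of_r m x : mult_of (mult_r m x) = mult_of x ** m.
Proof. by apply: multP => y /=; rewrite ?mult_rM ?mult_lr. Qed.
Lemma nrm_isom_r u x : unitary u -> nrm (mult_r u x) = nrm x.
Proof.
by move=> /unitaryJ uu; have := unitary_nrm x^# uu; rewrite /= adjK !nrm_adj.
Qed.

Variables (G : zmodType) (A : cstarAlgType R) (alpha : star_action G A).
Variables (pi : A -> multiplier B) (U : G -> multiplier B).
Hypothesis hc : covariant alpha pi U.

Lemma cov_unitary s : unitary (U s).
Proof. by split; [exact: cov_unitl hc s|exact: cov_unitr hc s]. Qed.

Lemma cov_comm s a : U s ** pi a = pi (alpha s a) ** U s.
Proof. by rewrite (cov_cov hc) -smulA (cov_unitl hc) multm1. Qed.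
End CovariantFacts.

Section DualActionFacts.
Variables (R : realType) (G : zmodType) (A : cstarAlgType R).
Variables (alpha : star_action G A) (X : crossed_product alpha).
Variables (ahat : star_action (dual_group R G) X).
Hypothesis hahat : is_dual_action ahat.

Lemma dual_action_inv_gen xi a s :
  aut_inv (ahat xi) (cp_gen X a s) = (xi s)^-1 *: cp_gen X a s.
Proof.
apply: (can_inj (aut_funK (ahat xi))).
by rewrite aut_invK (star_homZ (aut_hom _)) hahat scalerA mulVf ?scale1r // char_neq0.
Qed.

End DualActionFacts.

Section InducedAlgebra.
Variables (R : realType) (G : zmodType) (H : zmodClosed G).
Variables (A : cstarAlgType R) (gamma : star_action (Quotient.quot H) A).
Variables (AG : crossed_product (action_pullback (quot_map H) gamma)).
Variables (AGH : crossed_product gamma).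
Variables (betahat : star_action (dual_group R G) AG).
Variables (gammahat : star_action (dual_group R (Quotient.quot H)) AGH).
Hypotheses (hbetahat : is_dual_action betahat) (hgammahat : is_dual_action gammahat).
Variable Phi : AG -> AGH.
Hypothesis hPhi : integrated_form (cp_iA AGH) (fun s => cp_iG AGH (quot_map H s))
              (fun b => mult_of (Phi b)).

Local Notation q := (quot_map H).
Local Notation Psi b xi := (Phi (aut_inv (betahat xi) b)).

Lemma Phi_hom : star_hom Phi.
Proof.
have [h _] := hPhi; have m := mult_of_hom AGH.
split=> [c a b|a b|a]; apply: mult_of_inj.
- by rewrite (star_homP h) (star_homP m).
- by rewrite (star_homM h) (star_homM m).
- by rewrite (star_homJ h) (star_homJ m).
Qed.

Lemma Phi_gen a s : Phi (cp_gen AG a s) = cp_gen AGH a (q s).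
Proof. by apply: mult_of_inj; rewrite hPhi.2 cp_genE. Qed.

Lemma Psi_hom xi : star_hom (fun b => Psi b xi).
Proof. exact: star_hom_comp (aut_inv_hom _) Phi_hom. Qed.

Lemma Psi_gen a s xi : Psi (cp_gen AG a s) xi = (xi s)^-1 *: cp_gen AGH a (q s).
Proof. by rewrite (dual_action_inv_gen hbetahat) (star_homZ Phi_hom) Phi_gen. Qed.

Lemma Psi_nrm_le b xi : nrm (Psi b xi) <= nrm b.
Proof. exact: star_hom_nrm_le (Psi_hom xi). Qed.

Lemma quot_map_eq0 h : h \in H -> q h = 0.
Proof. by move=> hH; apply/eqP; rewrite -(raddf0 q) -Quotient.idealrBE subr0. Qed.

Lemma cp_iG_central h : h \in H -> central (cp_iG AG h).
Proof.
move=> hH; have cAG := cp_cov AG; have uh := cov_unitary cAG h.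
apply: (dense_span_ext (C := 1) (@cp_dense _ _ _ _ AG)).
- exact: mult_lP.
- exact: mult_rP.
- by move=> x; rewrite unitary_nrm // mul1r.
- by move=> x; rewrite nrm_isom_r // mul1r.
move=> _ /set_mem[a [s ->]]; apply: mult_of_inj.
rewrite mult_of_l mult_of_r !cp_genE smulA (cov_comm cAG) /= quot_map_eq0 // act0.
by rewrite -!smulA -!(cov_UD cAG) addrC.
Qed.

Section FiberRepresentation.
Variables (xi : dual_group R G) (p : cstar_seminorm AG).
Hypothesis xip : forall h x, h \in H -> p (x - xi h *: mult_l (cp_iG AG h) x) = 0.

Let pi a := mquot p (cp_iA AG a).
Let U (t : Quotient.quot H) := xi (repr t) *: mquot p (cp_iG AG (repr t)).

Let UE s : U (q s) = xi s *: mquot p (cp_iG AG s).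
Proof.
rewrite /U; set t := repr _.
have st : s - t \in H by rewrite Quotient.idealrBE /t reprK.
have uH h : h \in H -> xi h *: mquot p (cp_iG AG h) = mult1.
  move=> hH; have e x : xi h *: cqpi p (mult_l (cp_iG AG h) x) = cqpi p x.
    by rewrite -cqpiZ; apply/esym/cqpiP; exact: xip.
  apply: multP => a; rewrite -[a]cqrepK.
    by rewrite mult_lZm mquot_l e.
  rewrite -[mult_r _ _]/(xi h *: mult_r (mquot p (cp_iG AG h)) _) mquot_r.
  by rewrite -cp_iG_central // e.
rewrite -[s in RHS](subrK t) charD (cov_UD (cp_cov AG)) (star_homM (mquot_hom p)).
by rewrite -scalerA -smulZr -smulZl (uH _ st) mult1m.
Qed.

Lemma fiber_covariant : covariant gamma pi U.
Proof.
have cAG := cp_cov AG; have hq := mquot_hom p.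
have uU t : unitary (U t).
  apply: unitaryZ; first by rewrite /nrm norm_char.
  by split; rewrite -(star_homJ hq) -(star_homM hq)
     ?(cov_unitl cAG) ?(cov_unitr cAG) mquot1.
split.
- exact: star_hom_comp (cov_hom cAG) hq.
- move=> O [d Od] oO.
  have [e e0 eO] : exists2 e : R, 0 < e & ball d e%:C `<=` O.
    have /nbhs_ballP[_ /ltcP[e e0 ->] eO] : nbhs d O by exact: open_nbhs_nbhs.
    by exists e.
  have [y [n [c [w [wS yE]]]] hy] := nrm_denseP (@cov_nondeg _ _ _ _ _ _ _ cAG) (cqrep d) e0.
  exists (cqpi p y); split.
    apply: eO; rewrite -ball_normE /= nrmE ltcR -[d]cqrepK -cqpiB nrm_cqpi.
    by rewrite (le_lt_trans (csn_le _ _)).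
  exists n, c, (fun i => cqpi p (w i)); split => [i|].
    have [a [x ->]] := wS i; exists a, (cqpi p x).
    by rewrite mquot_l.
  rewrite yE; clear wS yE; elim: n c w => [|n ih] c w; first by rewrite !big_ord0 cqpi0.
  by rewrite !big_ord_recl cqpiD cqpiZ ih.
- by move=> t; have [] := uU t.
- by move=> t; have [] := uU t.
- rewrite -(raddf0 q) UE (cov_U0 cAG) mquot1.
  have -> : xi 0 = 1.
    by apply: (mulfI (char_neq0 xi 0)); rewrite -charD addr0 mulr1.
  by rewrite scale1r.
- move=> s t; rewrite -[s]quot_mapK -[t]quot_mapK -raddfD !UE.
  rewrite charD (cov_UD cAG) (star_homM hq) smulZl smulZr scalerA.
  by [].
- move=> t a; rewrite -[t]quot_mapK; set s := repr t; rewrite UE.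
  rewrite /pi adjZ !smulZl smulZr scalerA -normCK norm_char expr1n scale1r.
  rewrite -(star_homJ hq) -!(star_homM hq); congr (mquot p _).
  exact: cov_cov cAG s a.
Qed.

(** The factor [xi s] in [U] cancels the [(xi s)^-1] of the inverse dual action, so [L] after [Psi]
    at [xi] is the quotient map; contractivity of [L] gives the bound. *)
Lemma fiber_le b : p b <= nrm (Psi b xi).
Proof.
have [L [hL LE]] := cp_univ AGH fiber_covariant.
have key d x : mult_l (L (Psi x xi)) d = mult_l (mquot p (mult_of x)) d.
  move: x; apply: (dense_span_ext (f := fun x => mult_l (L (Psi x xi)) d)
    (g := fun x => mult_l (mquot p (mult_of x)) d) (C := nrm d) (@cp_dense _ _ _ _ AG)).
  - by move=> c x y; rewrite (star_homP (Psi_hom xi)) (star_homP hL).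
  - by move=> c x y; rewrite (star_homP (mult_of_hom _)) (star_homP (mquot_hom p)).
  - move=> x; rewrite (le_trans (star_hom_contr hL _ _)) // mulrC.
    by rewrite ler_wpM2l ?nrm_ge0 // Psi_nrm_le.
  - move=> x; rewrite mulrC; 
    exact: (star_hom_contr (star_hom_comp (mult_of_hom AG) (mquot_hom p)) x d).
  move=> _ /set_mem[a [s ->]].
  rewrite Psi_gen (star_homZ hL) LE UE smulZr scalerA mulVf ?char_neq0 // scale1r.
  by rewrite cp_genE (star_homM (mquot_hom p)).
(* Tested on the class of [b^#], the left side is [p b ^+ 2]. *)
have := star_hom_contr hL (Psi b xi) (cqpi p b^#).
rewrite key mquot_l /= !nrm_cqpi -{1}[b]adjK csnJM csn_adj.
have [->|p0] := eqVneq (p b) 0; first by rewrite nrm_ge0.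
by rewrite expr2 ler_pM2r // lt_def p0 csn_ge0.
Qed.
End FiberRepresentation.

Lemma Psi_nrm_ge b (r : R) : r < nrm b -> exists xi, r <= nrm (Psi b xi).
Proof.
(* Positive [r] is needed below, where [r <= p b] must make the class of [b] nonzero. *)
move=> rb; have [r0|r0] := leP r 0.
  by exists 0; rewrite (le_trans r0) // nrm_ge0.
have cAG := cp_cov AG.
pose I := {h : G | h \in H}; pose z (i : I) := cp_iG AG (val i).
have [lam [p [lam1 lamp pb]]] := @localization R AG I z
  (fun i => cp_iG_central (valP i)) (fun i => cov_unitary cAG (val i)) b r (ltW r0) rb.
pose f g := if insub g is Some i then lam i else 1.
have fH h (hH : h \in H) : f h = lam (Sub h hH) by rewrite /f insubT.
have fp h x : h \in H -> cqpi p x = f h *: cqpi p (mult_l (cp_iG AG h) x).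
  move=> hH; rewrite -cqpiZ; apply/cqpiP; rewrite (fH _ hH).
  exact: lamp (Sub h hH) x.
have [||xi xif] := @char_extend R G H f.
- move=> h k hH kH; have hkH : h + k \in H by rewrite rpredD.
  have hb : cqpi p b != 0.
    apply/eqP => b0; have : nrm (cqpi p b) = 0 by rewrite b0 nrm0.
    by rewrite nrm_cqpi => pb0; move: pb; rewrite pb0 leNgt r0.
  (* Both [f (h + k)] and [f h * f k] carry the class of [y] to that of [b], which is nonzero, so
     the scalars agree. *)
  pose y := mult_l (cp_iG AG (h + k)) b.
  have yE : y = mult_l (cp_iG AG h) (mult_l (cp_iG AG k) b).
    by rewrite /y (cov_UD cAG).
  have e1 : cqpi p b = f (h + k) *: cqpi p y by exact: fp.
  have e2 : cqpi p b = (f h * f k) *: cqpi p y.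
    by rewrite (fp k) // [cqpi p (mult_l _ b)](fp h) // scalerA mulrC yE.
  have y0 : cqpi p y != 0 by apply: contra hb => /eqP y0; rewrite e1 y0 scaler0.
  apply/eqP; rewrite -subr_eq0.
  have : (f (h + k) - f h * f k) *: cqpi p y == 0 by rewrite scalerBl -e1 -e2 subrr.
  by rewrite scaler_eq0 (negbTE y0) orbF.
- by move=> h hH; rewrite (fH _ hH) nrmE lam1.
exists xi; apply: le_trans pb (fiber_le _ b) => h x hH.
by rewrite xif // (fH _ hH); exact: lamp (Sub h hH) x.
Qed.

Lemma Psi_inj b b' : (forall xi, Psi b xi = Psi b' xi) -> b = b'.
Proof.
move=> h; apply/eqP; rewrite -subr_eq0; apply/eqP/nrm_eq0/eqP.
rewrite eq_le nrm_ge0 andbT leNgt; apply/negP => b0.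
have b2 : nrm (b - b') / 2 < nrm (b - b') by rewrite ltr_pdivrMr // ltr_pMr // ltr1n.
have [xi] := Psi_nrm_ge b2.
rewrite (star_homB (Psi_hom xi)) h subrr nrm0 leNgt.
by rewrite divr_gt0.
Qed.
End InducedAlgebra.

(** * The dual group and the induced algebra *)

Lemma continuous_sumr (K : numFieldType) (X : topologicalType) (V : normedModType K)
    n (F : 'I_n -> X -> V) : (forall i, continuous (F i)) ->
  continuous (fun x => \sum_(i < n) F i x).
Proof.
move=> cF x; apply: cvg_big => [|i _]; first exact: add_continuous.
exact: cF.
Qed.

Section DualGroupTopology.
Variables (R : realType) (G : zmodType).
Implicit Types (xi eta : dual_group R G).

Lemma dual_ev_near xi s (e : R) : 0 < e -> 
  \forall eta \near xi, nrm (xi s - (eta : dual_group R G) s) < e.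
Proof.
move=> e0.
have c : continuous (@dual_ptws R G : dual_group R G -> _) by exact: initial_continuous.
have h := @ptws_nrm_near R R[i]^o G (dual_ptws xi) s e e0.
exact: (c xi _ h).
Qed.

(** The image filter clusters at some [u] in the product of circles. Characters come close to [u] at
    [s], [t] and [s + t] simultaneously, so [u] is a character, and the initial topology brings the
    clustering back. *)
Lemma compact_dual_group : compact [set: dual_group R G].
Proof.
pose X : topologicalType := {ptws G -> R[i]^o}.
pose K : set X := [set u : X | forall s, circle (u s)].
have cK : compact K.
  by apply: (@tychonoff G (fun=> R[i]^o) (fun=> @circle R)) => _; exact: compact_circle.
move=> F FF _.
pose F' : set_system X := @dual_ptws R G @ F.
have FF' : ProperFilter F' by exact: fmap_proper_filter.
have F'K : F' K.
  by apply: (@filterS _ F _ setT _ _ filterT) => xi _ s; rewrite /circle /= /nrm norm_char.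
have [u [Ku uF]] := cK F' FF' F'K.
have uD s t : u (s + t) = u s * u t.
  apply/eqP; rewrite -subr_eq0; apply/eqP/nrm_small => e e0.
  have e3 : 0 < e / 3 by rewrite divr_gt0.
  pose U r := [set v : X | nrm (u r - v r) < e / 3].
  have nU r : nbhs u (U r) := @ptws_nrm_near R R[i]^o G u r _ e3.
  have F'T : F' (range (@dual_ptws R G)).
    by apply: (@filterS _ F _ setT _ _ filterT) => xi _; exists xi.
  have [_ [[xi _ <-] [[h1 h2] h3]]] :=
    uF _ _ F'T (filterI (filterI (nU (s + t)) (nU s)) (nU t)).
  rewrite /U /= /dual_ptws in h1 h2 h3.
  have -> : u (s + t) - u s * u t
     = (u (s + t) - xi (s + t)) - ((u s - xi s) * u t + xi s * (u t - xi t)).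
    by rewrite charD; ring.
  rewrite (le_trans (nrmD _ _)) // nrmN.
  have h4 := nrmD ((u s - xi s) * u t) (xi s * (u t - xi t)).
  rewrite !nrmM (Ku t : nrm _ = 1) mulr1 in h4.
  have n1 : nrm (xi s) = 1 by rewrite /nrm norm_char.
  by rewrite n1 mul1r in h4; lra.
have u1 s : `|u s| = 1 by rewrite nrmE (Ku s : nrm _ = 1).
exists (@Character R G u uD u1); split=> // A B FA.
rewrite nbhsE; move=> [V [[V' oV' <-] Vu] VB].
have FA' : F' (@dual_ptws R G @` A).
  by apply: (@filterS _ F _ A _ _ FA) => xi Axi; exists xi.
have [_ [[xi Axi <-] V'xi]] := uF _ _ FA' (open_nbhs_nbhs (conj oV' Vu)).
by exists xi; split => //; exact: VB.
Qed.
End DualGroupTopology.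

Section InducedMembership.
Variables (R : realType) (G : zmodType) (H : zmodClosed G).
Variables (A : cstarAlgType R) (gamma : star_action (Quotient.quot H) A).
Variables (AG : crossed_product (action_pullback (quot_map H) gamma)).
Variables (AGH : crossed_product gamma).
Variables (betahat : star_action (dual_group R G) AG).
Variables (gammahat : star_action (dual_group R (Quotient.quot H)) AGH).
Hypotheses (hbetahat : is_dual_action betahat) (hgammahat : is_dual_action gammahat).
Variable Phi : AG -> AGH.
Hypothesis hPhi : integrated_form (cp_iA AGH) (fun s => cp_iG AGH (quot_map H s))
              (fun b => mult_of (Phi b)).

Local Notation q := (quot_map H).
Local Notation Psi b xi := (Phi (aut_inv (betahat xi) b)).

Lemma Psi_continuous b : continuous (fun xi => Psi b xi).
Proof.
have span y : lin_span [set b | exists a s, b = cp_gen AG a s] y ->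
    continuous (fun xi => Psi y xi).
  move=> [n [c [w [wS ->]]]].
  have -> : (fun xi => Psi (\sum_(i < n) c i *: w i) xi)
      = (fun xi => \sum_(i < n) c i *: Psi (w i) xi).
    by apply/funext => xi; rewrite (star_hom_sum (Psi_hom betahat hPhi xi)).
  apply: (@continuous_sumr _ (dual_group R G)) => i.
  have [a [s ->]] := wS i.
  apply: (@nrm_continuousP R (dual_group R G)) => xi e e0.
  pose M := nrm (c i) * nrm (cp_gen AGH a (q s)) + 1.
  have M0 : 0 < M by rewrite ltr_wpDl // mulr_ge0 ?nrm_ge0.
  apply: (@filterS _ _ (@nbhs_filter (dual_group R G) xi) _ _ _
    (dual_ev_near xi s (divr_gt0 e0 M0))) => eta h.
  rewrite !(Psi_gen hbetahat hPhi) -scalerBr -scalerBl !nrmZ.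
  (* Inversion is isometric on the unit circle. *)
  have -> : nrm ((xi s)^-1 - (eta s)^-1) = nrm (xi s - eta s).
    have -> : (xi s)^-1 - (eta s)^-1 = (eta s - xi s) * ((xi s)^-1 * (eta s)^-1).
      by field; rewrite !char_neq0.
    rewrite !nrmM nrmB.
    have n1 z : nrm ((z : dual_group R G) s)^-1 = 1 by rewrite /nrm normfV norm_char invr1.
    by rewrite !n1 !mulr1.
  rewrite mulrCA; move: h; rewrite ltr_pdivlMr // => h; apply: le_lt_trans h.
  by rewrite ler_wpM2l ?nrm_ge0 // lerDl.
apply: (@nrm_continuousP R (dual_group R G)) => xi e e0.
have e3 : 0 < e / 3 by rewrite divr_gt0.
have [y Sy hy] := nrm_denseP (@cp_dense _ _ _ _ AG) b e3.
have hyn eta : nrm (Psi b eta - Psi y eta) < e / 3.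
  rewrite -(star_homB (Psi_hom betahat hPhi eta)).
  by apply: le_lt_trans hy; exact: Psi_nrm_le.
have FF := @nbhs_filter (dual_group R G) xi.
have := proj1 (@nrm_cvgP R _ _ _ (fun xi => Psi y xi) _ FF) (span y Sy xi) _ e3.
apply: (@filterS _ _ FF) => eta h.
have h1 := nrm_tri (Psi b xi) (Psi y xi) (Psi b eta).
have h2 := nrm_tri (Psi y xi) (Psi y eta) (Psi b eta).
have := hyn xi; have := hyn eta; rewrite nrmB => h3 h4; lra.
Qed.

Lemma Psi_equivariant b xi eta (Lh : annihilator H eta) :
  Psi b (xi + eta) = aut_inv (gammahat (char_descend Lh)) (Psi b xi).
Proof.
have hinv := aut_inv_hom (gammahat (char_descend Lh)).
have hP := Psi_hom betahat hPhi xi; have hP' := Psi_hom betahat hPhi (xi + eta).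
move: b; apply: (dense_span_ext (f := fun b => Psi b (xi + eta))
  (g := fun b => aut_inv (gammahat (char_descend Lh)) (Psi b xi))
  (C := 1) (@cp_dense _ _ _ _ AG)).
- exact: star_homP hP'.
- by move=> c x y; rewrite (star_homP hP) (star_homP hinv).
- by move=> x; rewrite mul1r; exact: Psi_nrm_le.
- by move=> x; rewrite mul1r star_aut_inv_nrm; exact: Psi_nrm_le.
move=> _ /set_mem[a [s ->]].
rewrite !(Psi_gen hbetahat hPhi) (star_homZ hinv) (dual_action_inv_gen hgammahat).
by rewrite scalerA char_descendE invfM.
Qed.

Lemma Psi_induced b : @induced_cstar R (dual_group R G) (annihilator H) AGH
  (fun h hH => gammahat (char_descend hH)) (fun xi => Psi b xi).
Proof. by split=> [|g h Lh]; [exact: Psi_continuous|exact: Psi_equivariant]. Qed.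
End InducedMembership.

(** * Density of the range *)

Lemma real_continuousP (R : realType) (X : topologicalType) (v : X -> R^o) :
  (forall x e, 0 < e -> \forall y \near x, `|v x - v y| < e) -> continuous v.
Proof. by move=> h x; apply/(@cvgrPdist_lt R R^o) => e /(h x). Qed.

Lemma bounded_of_compact (R : realType) (X : topologicalType) (v : X -> R^o) :
  compact [set: X] -> continuous v -> exists C : R, forall x, v x <= C.
Proof.
move=> cX cv; pose C n := v @^-1` [set r | n%:R <= r].
have cC n : closed (C n).
  by apply: closed_comp => [x _|]; [exact: cv|exact: closed_ge].
have [ne|/existsNP[n hn]] := pselect (forall n, ([set: X] `&` C n) !=set0).
  have [|x _ xC] := compact_directed 0%N cX cC ne.
    move=> m n; exists (maxn m n) => x [_]; rewrite /C /= => h.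
    by split; apply: le_trans h; rewrite ler_nat ?leq_maxl ?leq_maxr.
  have := xC (Num.bound (v x)); rewrite /C /= leNgt.
  have [v0|v0] := leP 0 (v x); first by rewrite archi_boundP.
  by rewrite (lt_le_trans v0).
exists n%:R => x; rewrite leNgt; apply/negP => /ltW nx.
by apply: hn; exists x.
Qed.

(** * Trigonometric peak functions on the dual group *)

Section PeakFunctions.
Variables (R : realType) (G : zmodType).
Implicit Types (xi eta : dual_group R G) (h : G).

Lemma nrm_char eta s : nrm (eta s) = 1.
Proof. by rewrite /nrm norm_char. Qed.
Lemma charN eta s : eta (- s) = (eta s)^-1.
Proof.
apply: (mulfI (char_neq0 eta s)); rewrite -charD subrr mulfV ?char_neq0 //.
by apply: (mulfI (char_neq0 eta 0)); rewrite -charD addr0 mulr1.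
Qed.

(* Equal to [1] at [eta] if and only if [eta h = xi h], by [|eta h / xi h| = 1]. *)
Definition peak xi h eta : R := (1 + complex.Re (eta h * (xi h)^-1)) / 2.
Definition peaks xi (l : seq G) eta : R := \prod_(h <- l) peak xi h eta.

Let nw xi h eta : nrm (eta h * (xi h)^-1) = 1.
Proof. by rewrite nrmM -charN !nrm_char mulr1. Qed.

Lemma peak_ge0 xi h eta : 0 <= peak xi h eta.
Proof.
rewrite divr_ge0 //; have := nrm_ge_Re (eta h * (xi h)^-1).
by rewrite nw ler_norml => /andP[]; lra.
Qed.
Lemma peak_le1 xi h eta : peak xi h eta <= 1.
Proof.
have := nrm_ge_Re (eta h * (xi h)^-1).
by rewrite nw ler_norml /peak => /andP[]; lra.
Qed.
Lemma peak_refl xi h : peak xi h xi = 1.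
Proof. by rewrite /peak mulfV ?char_neq0 //= -mulr2n divff. Qed.
Lemma peak_eq1 xi h eta : peak xi h eta = 1 -> eta h = xi h.
Proof.
rewrite /peak; set w := eta h * _ => h1; have r1 : complex.Re w = 1 by lra.
have := add_Re2_Im2 w; rewrite nrmE nw r1 -(rmorphXn (real_complex R)) => /(fmorph_inj (real_complex R)) H.
have i0 : complex.Im w = 0.
  by apply/eqP; rewrite -sqrf_eq0; apply/eqP; move: H; rewrite !expr1n; lra.
have w1 : w = 1 by rewrite [w]complexE r1 i0 mulr0 addr0.
by rewrite -[RHS]mul1r -w1 /w divfK // char_neq0.
Qed.
Lemma peak_continuous xi h : continuous (peak xi h : dual_group R G -> R^o).
Proof.
apply: (@real_continuousP R (dual_group R G)) => eta e e0.
apply: (@filterS _ _ (@nbhs_filter (dual_group R G) eta) _ _ _ (dual_ev_near eta h e0)).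
move=> mu; apply: le_lt_trans.
have -> : peak xi h eta - peak xi h mu = complex.Re ((eta h - mu h) * (xi h)^-1) / 2.
  by rewrite mulrBl raddfB /= /peak; ring.
rewrite normrM [`|2^-1|]ger0_norm // ler_pdivrMr // (le_trans (nrm_ge_Re _)) //.
by rewrite nrmM -charN nrm_char mulr1 ler_peMr ?nrm_ge0 // ler1n.
Qed.

Lemma peaks_ge0 xi l eta : 0 <= peaks xi l eta.
Proof. by apply: prodr_ge0 => h _; exact: peak_ge0. Qed.
Lemma peaks_le1 xi l eta : peaks xi l eta <= 1.
Proof.
elim: l => [|h l ih]; first by rewrite /peaks big_nil.
by rewrite /peaks big_cons mulr_ile1 ?peak_ge0 ?peak_le1 // peaks_ge0.
Qed.
Lemma peaks_cat xi l l' eta : peaks xi (l ++ l') eta = peaks xi l eta * peaks xi l' eta.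
Proof. by rewrite /peaks big_cat. Qed.
Lemma peaks_refl xi l : peaks xi l xi = 1.
Proof. by rewrite /peaks big1 // => h _; exact: peak_refl. Qed.
Lemma peaks_continuous xi l : continuous (peaks xi l : dual_group R G -> R^o).
Proof.
elim: l => [|h l ih].
  have -> : peaks xi [::] = fun=> 1 by apply/funext => eta; rewrite /peaks big_nil.
  exact: cst_continuous.
have -> : peaks xi (h :: l) = fun eta => peak xi h eta * peaks xi l eta.
  by apply/funext => eta; rewrite /peaks big_cons.
move=> eta; apply: (@continuousM R (dual_group R G)); [exact: peak_continuous|exact: ih].
Qed.
End PeakFunctions.

(** * Approximation of the induced algebra by the range *)

Section Density.
Variables (R : realType) (G : zmodType) (H : zmodClosed G).
Variables (A : cstarAlgType R) (gamma : star_action (Quotient.quot H) A).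
Variables (AG : crossed_product (action_pullback (quot_map H) gamma)).
Variables (AGH : crossed_product gamma).
Variables (betahat : star_action (dual_group R G) AG).
Variables (gammahat : star_action (dual_group R (Quotient.quot H)) AGH).
Hypotheses (hbetahat : is_dual_action betahat) (hgammahat : is_dual_action gammahat).
Variable Phi : AG -> AGH.
Hypothesis hPhi : integrated_form (cp_iA AGH) (fun s => cp_iG AGH (quot_map H s))
              (fun b => mult_of (Phi b)).

Local Notation q := (quot_map H).
Local Notation Psi b xi := (Phi (aut_inv (betahat xi) b)).
Local Notation dual := (dual_group R G).
Implicit Types (xi eta : dual) (b : AG).

Definition acts_on_range (v : dual -> R) := forall b, exists b', forall eta : dual,
  Psi b' eta = (v eta)%:C *: Psi b eta.

Lemma acts_cst (r : R) : acts_on_range (fun=> r).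
Proof. by move=> b; exists (r%:C *: b) => eta; rewrite (star_homZ (Psi_hom betahat hPhi eta)). Qed.
Lemma actsD u v : acts_on_range u -> acts_on_range v -> acts_on_range (fun x => u x + v x).
Proof.
move=> hu hv b; have [[b1 h1] [b2 h2]] := (hu b, hv b); exists (b1 + b2) => eta.
by rewrite (star_homD (Psi_hom betahat hPhi eta)) h1 h2 rmorphD scalerDl.
Qed.
Lemma actsM u v : acts_on_range u -> acts_on_range v -> acts_on_range (fun x => u x * v x).
Proof.
move=> hu hv b; have [b1 h1] := hv b; have [b2 h2] := hu b1; exists b2 => eta.
by rewrite h2 h1 scalerA rmorphM.
Qed.
Lemma actsX u n : acts_on_range u -> acts_on_range (fun x => u x ^+ n).
Proof.
move=> hu; elim: n => [|n ih].
  by move=> b; have [b' hb'] := acts_cst 1 b; exists b' => eta; rewrite expr0.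
move=> b; have [b' hb'] := actsM hu ih b; exists b' => eta.
by rewrite exprS.
Qed.

(** Source of the scalar functions that preserve the range: [i_G(h)] shifts a generator from [s] to
    [h + s], which is invisible in [G / H] and leaves only the phase. *)
Lemma Psi_mult_iG h b eta : h \in H ->
  Psi (mult_l (cp_iG AG h) b) eta = (eta h)^-1 *: Psi b eta.
Proof.
move=> hH; have hP := Psi_hom betahat hPhi eta; have cAG := cp_cov AG.
have uh := cov_unitary cAG h.
move: b; apply: (dense_span_ext (f := fun b => Psi (mult_l (cp_iG AG h) b) eta)
  (g := fun b => (eta h)^-1 *: Psi b eta) (C := 1) (@cp_dense _ _ _ _ AG)).
- by move=> c x y; rewrite mult_lP (star_homP hP).
- by move=> c x y; rewrite (star_homP hP) scalerDr !scalerA mulrC.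
- by move=> x; rewrite mul1r -[leRHS](unitary_nrm _ uh); exact: Psi_nrm_le.
- move=> x; rewrite mul1r nrmZ1; first exact: Psi_nrm_le.
  by rewrite -charN nrm_char.
move=> _ /set_mem[a [s ->]].
have -> : mult_l (cp_iG AG h) (cp_gen AG a s) = cp_gen AG a (h + s).
  apply: mult_of_inj; rewrite mult_of_l !cp_genE smulA (cov_comm cAG) /= quot_map_eq0 // act0.
  by rewrite -smulA -(cov_UD cAG).
rewrite !(Psi_gen hbetahat hPhi) scalerA charD invfM raddfD /=.
by rewrite quot_map_eq0 // add0r.
Qed.

Lemma acts_peak xi h : h \in H -> acts_on_range (peak xi h).
Proof.
move=> hH b; have hN : - h \in H by rewrite rpredN.
pose w eta : R[i] := eta h * (xi h)^-1.
(* As [w] has modulus one, its real part is [(w + w^-1) / 2]; the elements [- h] and [h] supply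
   [eta h] and its inverse. *)
exists ((2^-1)%:C *: b + (4^-1)%:C *:
  ((xi h)^-1 *: mult_l (cp_iG AG (- h)) b + xi h *: mult_l (cp_iG AG h) b)) => eta.
have hP := Psi_hom betahat hPhi eta.
rewrite !(star_homD hP, star_homZ hP) !Psi_mult_iG // charN invrK.
rewrite !scalerA -!scalerDl !scalerA -scalerDl; congr (_ *: _).
have w1 : `|w eta| = 1 by rewrite /w normrM normfV !norm_char invr1 mulr1.
have -> : (xi h)^-1 * eta h + xi h * (eta h)^-1 = 2 * (complex.Re (w eta))%:C.
  rewrite complexRe ReE [RHS]mulrC divfK ?pnatr_eq0 //.
  have -> : ((w eta)^*)%R = (w eta)^-1 by rewrite invC_norm w1 expr1n invr1 mul1r.
  by rewrite /w invfM invrK mulrC; congr (_ + _); rewrite mulrC.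
rewrite /peak -/(w eta) !fmorphV !rmorph_nat rmorphM rmorphD fmorphV rmorph_nat rmorph1.
by field.
Qed.

Variable f : dual -> AGH.
Hypothesis hf : @induced_cstar R dual (annihilator H) AGH
  (fun h hH => gammahat (char_descend hH)) f.

Let dist b (eta : dual) : R^o := nrm (f eta - Psi b eta).

Let dist_continuous b : continuous (dist b).
Proof.
move=> eta; have fc : {for eta, continuous (fun eta => f eta - Psi b eta)}.
  by apply: (@continuousB _ _ dual); [exact: hf.1|exact: Psi_continuous].
exact: (@continuous_comp dual AGH R^o (fun eta => f eta - Psi b eta) (@nrm R AGH) eta fc (@nrm_continuous R AGH _)).
Qed.

(** [f] and [Psi b] move along a coset of the annihilator by the same automorphism, which is
    isometric. *)
Let dist_invariant b (xi eta : dual) : (forall h, h \in H -> eta h = xi h) ->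
  dist b eta = dist b xi.
Proof.
move=> e; have Lh : annihilator H (eta - xi).
  by move=> h hH; rewrite /= e // mulfV // char_neq0.
have -> : eta = xi + (eta - xi) by rewrite addrC subrK.
rewrite /dist (hf.2 _ _ Lh) (Psi_equivariant hbetahat hgammahat hPhi _ _ Lh).
by rewrite -(star_homB (aut_inv_hom _)) star_aut_inv_nrm.
Qed.

Lemma local_value xi (e : R) : 0 < e -> exists b, nrm (f xi - Psi b xi) < e.
Proof.
move=> e0; have hP := Psi_hom betahat hPhi xi.
have [_ [n [c [w [wS ->]]]] hy] := nrm_denseP (@cp_dense _ _ _ _ AGH) (f xi) e0.
have /choice[b hb] : forall i, exists b, Psi b xi = w i.
  move=> i; have [a [t ->]] := wS i.
  exists (xi (repr t) *: cp_gen AG a (repr t)).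
  rewrite (star_homZ hP) (Psi_gen hbetahat hPhi) scalerA mulfV ?char_neq0 // scale1r.
  by rewrite quot_mapK.
exists (\sum_(i < n) c i *: b i); rewrite (star_hom_sum hP).
by under eq_bigr do rewrite hb.
Qed.

(** High powers of [v] serve as weights: they are at least 1 near [xi] and uniformly small where
    [Psi b] misses [f] by [e] or more. *)
Record local_approx (e : R) xi (b : AG) (v : dual -> R) (th : R) : Prop := LocalApprox {
  la_acts : acts_on_range v;
  la_cont : continuous (v : dual -> R^o);
  la_ge0 : forall eta, 0 <= v eta;
  la_gt1 : 1 < v xi;
  la_th0 : 0 <= th;
  la_th1 : th < 1;
  la_far : forall eta : dual, e <= nrm (f eta - Psi b eta) -> v eta <= th
}.

Lemma local_approx_exists (e : R) xi : 0 < e ->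
  exists bvt : AG * (dual -> R) * R, local_approx e xi bvt.1.1 bvt.1.2 bvt.2.
Proof.
move=> e0; have [b hb] := local_value xi e0.
have [l lH [a [a0 a1] la]] : exists2 l : seq G, {in l, forall h, h \in H} &
    exists2 a : R, 0 <= a /\ a < 1 & forall eta, e <= dist b eta -> peaks xi l eta <= a.
  (* Otherwise some [eta] at distance at least [e] has all its peaks equal to 1. It then agrees with
     [xi] on [H], and [dist_invariant] contradicts the choice of [b]. *)
  apply: contrapT => hn.
  pose I := {h : G | h \in H}.
  pose C (ln : seq I * nat) : set dual := [set eta | e <= dist b eta] `&`
    [set eta | 1 - ln.2.+1%:R^-1 <= peaks xi (map val ln.1) eta].
  have cC ln : closed (C ln).
    apply: closedI.
      have -> : [set eta | e <= dist b eta] = dist b @^-1` [set r | e <= r] by [].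
      by apply: closed_comp => [x _|]; [exact: dist_continuous|exact: closed_ge].
    have -> : [set eta | 1 - ln.2.+1%:R^-1 <= peaks xi (map val ln.1) eta]
      = (peaks xi (map val ln.1) : dual -> R^o) @^-1` [set r | 1 - ln.2.+1%:R^-1 <= r] by [].
    by apply: closed_comp => [x _|]; [exact: peaks_continuous|exact: closed_ge].
  have ne ln : ([set: dual] `&` C ln) !=set0.
    apply: contrapT => hne; apply: hn; exists (map val ln.1).
      by move=> _ /mapP[h _ ->]; exact: valP.
    exists (1 - ln.2.+1%:R^-1).
      by rewrite subr_ge0 invf_le1 ?ltr0n // ler1n gtrBl invr_gt0 ltr0n.
    move=> eta he; rewrite leNgt; apply/negP => /ltW hp.
    by apply: hne; exists eta.
  have [|eta _ hC] := compact_directed ([::], 0%N) (@compact_dual_group R G) cC ne.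
    move=> [l m] [l' m']; exists (l ++ l', maxn m m') => eta [_ []] /= he.
    have mm k : (k <= maxn m m')%N -> 1 - k.+1%:R^-1 <= 1 - (maxn m m').+1%:R^-1 :> R.
      by move=> km; rewrite lerB // lef_pV2 ?posrE ?ltr0n // ler_nat ltnS.
    rewrite map_cat peaks_cat => hp; split; split=> //=.
      apply: le_trans (mm m (leq_maxl _ _)) (le_trans hp _).
      by rewrite ler_piMr ?peaks_ge0 ?peaks_le1.
    apply: le_trans (mm m' (leq_maxr _ _)) (le_trans hp _).
    by rewrite ler_piMl ?peaks_ge0 ?peaks_le1.
  have := (hC ([::], 0%N)).1; rewrite /= (dist_invariant b (xi := xi)) => [|h hH].
    by rewrite leNgt hb.
  apply: peak_eq1; apply/eqP; rewrite eq_le peak_le1 /=.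
  apply/ler_addgt0Pr => d d0.
  have := (hC ([:: Sub h hH], Num.bound d^-1)).2.
  rewrite /= /peaks big_seq1 lerBlDr => /le_trans; apply; rewrite lerD2l.
  rewrite -[leRHS]invrK lef_pV2 ?posrE ?invr_gt0 ?ltr0n //.
  apply/ltW/(lt_le_trans (archi_boundP _)); first by rewrite invr_ge0 ltW.
  by rewrite ler_nat.
(* Dividing by a number strictly between [a] and 1 pushes the value at [xi] above 1 and keeps the
   far values below 1. *)
pose a' := (a + 1) / 2; have a'0 : 0 < a' by rewrite /a'; lra.
exists (b, fun eta => a'^-1 * peaks xi l eta, a'^-1 * a); split => /=.
- apply: actsM; first exact: acts_cst.
  elim: l lH {la} => [|h l ih] lH.
    move=> c; have [c' hc] := acts_cst 1 c; exists c' => eta.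
    by rewrite /peaks big_nil.
  have hH : h \in H by rewrite lH ?mem_head.
  have lH' : {in l, forall k, k \in H} by move=> k kl; rewrite lH // inE kl orbT.
  move=> c; have [c' hc] := actsM (acts_peak xi hH) (ih lH') c; exists c' => eta.
  by rewrite /peaks big_cons hc.
- move=> eta; apply: (@continuousM R dual); first exact: cst_continuous.
  exact: peaks_continuous.
- by move=> eta; rewrite mulr_ge0 ?invr_ge0 ?peaks_ge0 // ltW.
- by rewrite peaks_refl mulr1 invf_gt1 // /a'; lra.
- by rewrite mulr_ge0 ?invr_ge0 // ltW.
- by rewrite mulrC ltr_pdivrMr // mul1r /a'; lra.
- by move=> eta he; rewrite ler_wpM2l ?invr_ge0 ?(ltW a'0) // la.
Qed.

(* [1 / g] is the limit of [\sum_(k < n) (1 - g / C) ^+ k / C]. *)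
Lemma divide_range (g : dual -> R) (C : R) b (e : R) : acts_on_range g -> 0 < e ->
  (forall eta, 1 <= g eta) -> (forall eta, g eta <= C) ->
  exists b', forall eta : dual, nrm ((g eta)%:C *: Psi b' eta - Psi b eta) <= e.
Proof.
move=> ag e0 g1 gC; have C1 : 1 <= C by exact: le_trans (g1 0) (gC 0).
have C0 : 0 < C by rewrite (lt_le_trans ltr01).
pose u eta := 1 + (- C^-1) * g eta.
have au : acts_on_range u.
  by apply: actsD; [exact: acts_cst|apply: actsM; [exact: acts_cst|exact: ag]].
have u0 eta : 0 <= u eta.
  by rewrite /u mulNr subr_ge0 ler_pdivrMl // mulr1.
have us eta : u eta <= 1 - C^-1.
  by rewrite /u mulNr lerB // ler_peMr // invr_ge0 ltW.
have approx n : exists b', forall eta : dual,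
    (g eta)%:C *: Psi b' eta = (1 - u eta ^+ n)%:C *: Psi b eta.
  elim: n => [|n [b1 h1]].
    exists 0 => eta; rewrite (star_hom0 (Psi_hom betahat hPhi eta)) scaler0.
    by rewrite expr0 subrr scale0r.
  have [b2 h2] := actsM (acts_cst C^-1) (actsX n au) b.
  exists (b1 + b2) => eta; rewrite (star_homD (Psi_hom betahat hPhi eta)).
  rewrite scalerDr h1 h2 scalerA -rmorphM -scalerDl -rmorphD; congr (_%:C *: _).
  by rewrite exprS /u; field; rewrite gt_eqF.
have s0 : 0 <= 1 - C^-1 by rewrite subr_ge0 invf_le1.
have s1 : 1 - C^-1 < 1 by rewrite gtrBl invr_gt0.
have [n /ltW hn] := geom_small (nrm_ge0 b) s0 s1 e0.
have [b' hb'] := approx n; exists b' => eta.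
rewrite hb' rmorphB scalerBl rmorph1 scale1r addrAC subrr add0r nrmN nrmZ nrmC.
apply: le_trans hn; rewrite mulrC ler_pM ?nrm_ge0 ?normr_ge0 //; first exact: Psi_nrm_le.
by rewrite ger0_norm ?exprn_ge0 // lerXn2r // nnegrE.
Qed.

Lemma sum_geom_small (T : Type) (L : seq T) (C th : T -> R) (e : R) : 0 < e ->
  (forall x, 0 <= C x) -> (forall x, 0 <= th x) -> (forall x, th x < 1) ->
  exists n, \sum_(x <- L) C x * th x ^+ n <= e.
Proof.
move=> e0 C0 t0 t1.
(* Holding from [N] on, rather than at one [n], lets the induction combine thresholds by [maxn]. *)
suff : forall d, 0 < d -> exists N, forall n, (N <= n)%N -> \sum_(x <- L) C x * th x ^+ n <= d.
  by move=> /(_ e e0)[N hN]; exists N; exact: hN.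
elim: L => [|x L ih] d d0; first by exists 0%N => n _; rewrite big_nil ltW.
have d2 : 0 < d / 2 by rewrite divr_gt0.
have [N hN] := ih _ d2; have [m /ltW hm] := geom_small (C0 x) (t0 x) (t1 x) d2.
exists (maxn N m) => n; rewrite geq_max => /andP[Nn mn].
rewrite big_cons [d]splitr lerD ?hN //; apply: le_trans hm.
by rewrite ler_wpM2l // ler_wiXn2l // ltW.
Qed.

(** With weights [v ^+ n] of sum [g], the approximant is the weighted mean of local ones, the
    division being left to [divide_range]. After multiplication by [g] the error is at most
    [g e / 3] from near points, [e / 3] from far ones and [e / 3] from the division; [1 <= g] gives
    the total [g e]. *)
Lemma induced_approx (e : R) : 0 < e ->
  exists b, forall eta : dual, nrm (f eta - Psi b eta) <= e.
Proof.
move=> e0; have e3 : 0 < e / 3 by rewrite divr_gt0.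
have /choice[bvt hbvt] := fun xi => local_approx_exists xi e3.
pose bb xi := (bvt xi).1.1; pose vv xi := (bvt xi).1.2; pose tt xi := (bvt xi).2.
have {}hbvt xi : local_approx (e / 3) xi (bb xi) (vv xi) (tt xi) := hbvt xi.
have cpt := @compact_dual_group R G.
(* Otherwise the closed sets where [vv xi <= 1] for all [xi] in [L] share a point [eta], against
   [1 < vv eta eta]. *)
have [L hL] : exists L : seq dual, forall eta, exists2 xi, xi \in L & 1 < vv xi eta.
  apply: contrapT => hn.
  pose C (L : seq dual) := \bigcap_(xi in [set xi | xi \in L])
    ((vv xi : dual -> R^o) @^-1` [set r | r <= 1]).
  have cC L : closed (C L).
    apply: closed_bigI => xi _.
    by apply: closed_comp => [x _|]; [exact: la_cont (hbvt xi) x|exact: closed_le].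
  have ne L : ([set: dual] `&` C L) !=set0.
    apply: contrapT => hne; apply: hn; exists L => eta; apply: contrapT => heta.
    apply: hne; exists eta; split=> // xi xiL; rewrite /= leNgt; apply/negP => h.
    by apply: heta; exists xi.
  have [|eta _ hC] := compact_directed [::] cpt cC ne.
    move=> L L'; exists (L ++ L') => eta [_ h].
    by split=> xi xiL; apply: h; rewrite /= mem_cat xiL ?orbT.
  have := hC [:: eta] eta; rewrite /= mem_head => /(_ isT).
  by rewrite leNgt (la_gt1 (hbvt eta)).
have /choice[C hC] : forall xi, exists C : R, forall eta, dist (bb xi) eta <= C.
  by move=> xi; exact: bounded_of_compact cpt (@dist_continuous _).
have C0 xi : 0 <= C xi by apply: le_trans (hC xi 0); exact: nrm_ge0.
have [n hn] := sum_geom_small L e3 C0 (fun xi => la_th0 (hbvt xi)) (fun xi => la_th1 (hbvt xi)).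
pose g eta := \sum_(xi <- L) vv xi eta ^+ n.
have v0 xi eta : 0 <= vv xi eta ^+ n by rewrite exprn_ge0 // (la_ge0 (hbvt xi)).
have g1 eta : 1 <= g eta.
  have [xi xiL /ltW v1] := hL eta.
  rewrite /g (big_rem xi) //= -[1]addr0 lerD ?exprn_ege1 //.
  by apply: sumr_ge0 => *; exact: v0.
have ag : acts_on_range g.
  rewrite /g; elim: (L) => [|xi L' ih] b.
    by have [b' hb'] := acts_cst 0 b; exists b' => eta; rewrite big_nil.
  have [b' hb'] := actsD (actsX n (la_acts (hbvt xi))) ih b.
  by exists b' => eta; rewrite big_cons.
have [D gD] : exists D : R, forall eta, g eta <= D.
  have /choice[B hB] : forall xi, exists B : R, forall eta, vv xi eta <= B.
    by move=> xi; exact: bounded_of_compact cpt (la_cont (hbvt xi)).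
  exists (\sum_(xi <- L) B xi ^+ n) => eta; apply: ler_sum => xi _.
  have vp := la_ge0 (hbvt xi) eta.
  by rewrite lerXn2r ?nnegrE ?hB // (le_trans vp).
have [bF hF] : exists bF, forall eta : dual,
    Psi bF eta = \sum_(xi <- L) (vv xi eta ^+ n)%:C *: Psi (bb xi) eta.
  elim: (L) => [|xi L' [b1 h1]].
    by exists 0 => eta; rewrite big_nil (star_hom0 (Psi_hom betahat hPhi eta)).
  have [b2 h2] := actsX n (la_acts (hbvt xi)) (bb xi).
  exists (b2 + b1) => eta; rewrite big_cons (star_homD (Psi_hom betahat hPhi eta)).
  by rewrite h2 h1.
have [b hb] := divide_range bF ag e3 g1 gD.
exists b => eta; have gp : 0 < g eta by rewrite (lt_le_trans ltr01).
rewrite -(ler_pM2l gp).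
have -> : g eta * nrm (f eta - Psi b eta)
    = nrm ((g eta)%:C *: f eta - (g eta)%:C *: Psi b eta).
  by rewrite -scalerBr nrmZ nrmC gtr0_norm.
rewrite (le_trans (nrm_tri _ (Psi bF eta) _)) //.
have h1 : nrm (Psi bF eta - (g eta)%:C *: Psi b eta) <= e / 3 by rewrite nrmB.
(* Each summand is bounded by its near or its far estimate, and the sum of the two covers both
   cases. *)
have h2 : nrm ((g eta)%:C *: f eta - Psi bF eta) <= g eta * (e / 3) + e / 3.
  rewrite hF /g rmorph_sum scaler_suml -sumrB.
  rewrite (le_trans (nrm_sum _ _)) // mulr_suml.
  apply: le_trans (_ : _ <= \sum_(xi <- L) (vv xi eta ^+ n * (e / 3) + C xi * tt xi ^+ n)) _.
    apply: ler_sum => xi _; rewrite -scalerBr nrmZ nrmC ger0_norm ?v0 //.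
    have t0 : 0 <= C xi * tt xi ^+ n by rewrite mulr_ge0 // exprn_ge0 // (la_th0 (hbvt xi)).
    have [near|far] := leP (e / 3) (nrm (f eta - Psi (bb xi) eta)); last first.
      by rewrite -[leLHS]addr0 lerD // ler_wpM2l // ltW.
    rewrite -[leLHS]add0r lerD //; first by rewrite mulr_ge0 // ltW.
    rewrite mulrC ler_pM ?nrm_ge0 ?v0 //; first exact: hC.
    by rewrite lerXn2r ?nnegrE ?(la_ge0 (hbvt xi)) ?(la_th0 (hbvt xi)) // (la_far (hbvt xi)).
  by rewrite big_split lerD.
have gE : e / 3 <= g eta * (e / 3) by rewrite ler_peMl // ltW.
by have -> : g eta * e = 3 * (g eta * (e / 3)); [field|lra].
Qed.

Lemma induced_Psi : exists b, f = (fun xi => Psi b xi).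
Proof.
have h0 n : 0 < (2^-1 : R) ^+ n by rewrite exprn_gt0.
have /choice[u hu] := fun n => induced_approx (h0 n).
(* In every fibre the difference is at most [3/2] times [2^-1 ^+ n]. The constant 2 leaves a strict
   gap, since [Psi_nrm_ge] yields only a weak inequality. *)
have du n : nrm (u n.+1 - u n) <= 2 * 2^-1 ^+ n.
  rewrite leNgt; apply/negP => /(Psi_nrm_ge hbetahat hPhi)[xi].
  rewrite (star_homB (Psi_hom betahat hPhi xi)).
  have := nrm_tri (Psi (u n.+1) xi) (f xi) (Psi (u n) xi).
  have := hu n xi; have := hu n.+1 xi; rewrite exprS => h1 h2.
  rewrite [nrm (_ - f xi)]nrmB => h3 h4; suff : (0 : R) < 0 by rewrite ltxx.
  by have := h0 n; lra.
have [||l hl] := geom_cvg _ _ du; first by rewrite invr_ge0.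
  by rewrite invf_lt1 // ltr1n.
exists l; apply/funext => xi; apply/eqP; rewrite -subr_eq0; apply/eqP/nrm_small => e e0.
(* 5 is [2 / (1 - 1/2)] from the tail bound plus 1 from [hu]. *)
have [||||n /ltW hn] := @geom_small R 5 2^-1 e => //; first by rewrite invf_lt1 // ltr1n.
apply: le_trans hn; apply: le_trans (nrm_tri _ (Psi (u n) xi) _) _.
have := hu n xi; have := hl n.
have -> : (1 - 2^-1 : R)^-1 = 2.
  by apply: (mulIf (x := 1 - 2^-1)); [lra|rewrite mulVf; lra].
have := Psi_nrm_le betahat hPhi (l - u n) xi.
rewrite (star_homB (Psi_hom betahat hPhi xi)) [nrm (Psi (u n) xi - _)]nrmB.
by lra.
Qed.
End Density.

Theorem theorem3p2 (R : realType) (G : zmodType) (H : zmodClosed G)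
    (A : cstarAlgType R) (gamma : star_action (Quotient.quot H) A)
    (AG : crossed_product (action_pullback (quot_map H) gamma))
    (AGH : crossed_product gamma)
    (betahat : star_action (dual_group R G) AG)
    (gammahat : star_action (dual_group R (Quotient.quot H)) AGH)
    (hbetahat : is_dual_action betahat) (hgammahat : is_dual_action gammahat)
    (Phi : AG -> AGH)
    (hPhi : integrated_form (cp_iA AGH) (fun s => cp_iG AGH (quot_map H s))
              (fun b => mult_of (Phi b))) :
  let Psi (b : AG) (xi : dual_group R G) : AGH := Phi (aut_inv (betahat xi) b) in
  [/\ star_hom Psi,
      injective Psi &
      range Psi =
        @induced_cstar R (dual_group R G) (annihilator H) AGH
          (fun h hH => gammahat (char_descend hH))].
Proof.
move=> Psi; have hP := Psi_hom betahat hPhi; split.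
- split=> [c a b|a b|a]; apply/funext => xi.
  + exact: star_homP (hP xi) c a b.
  + exact: star_homM (hP xi) a b.
  + exact: star_homJ (hP xi) a.
- move=> b b' e; apply: (Psi_inj hbetahat hPhi) => xi.
  exact (congr1 (fun u : dual_group R G -> AGH => u xi) e).
- apply/seteqP; split=> [_ [b _ <-]|f hf].
    exact: Psi_induced.
  by have [b ->] := induced_Psi hbetahat hgammahat hPhi hf; exists b.
Qed.
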